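(* Let $q>1$ and let $m_1<m_2<\cdots$ be positive integers with $\frac{m_{k+1}}{m_k}\ge q$ for all $k\in\mathbb{N}$. Let $(a_{k,n})_{1\le k\le n}$ be a triangular array of real numbers, and put $$S_n^{\mathrm W}(x)=\sum_{k=1}^n a_{k,n}W_{m_k}(x),\quad 0\le x\le 1,\qquad A_n=\Big(\sum_{k=1}^n a_{k,n}^2\Big)^{1/2},\qquad d_n=\max_{1\le k\le n}|a_{k,n}|,$$ where $W_m$ denotes the $m$th Walsh function. Suppose $A_n\to\infty$ as $n\to\infty$, and moreover that, as $n\to\infty$, - if $q\ge 2$: $\sum_{k=1}^n a_{k,n}^4\to\kappa_4<\infty$ and $n\,d_n^5\to 0$; - if $1<q<2$: there exists $\varepsilon>0$ such that $n^{1+\varepsilon}d_n^3\to 0$. Then $(S_n^{\mathrm W})_{n\in\mathbb{N}}$, regarded as random variables on $[0,1]$ with Lebesgue measure, converges mod-Gaussian on $\mathbb{C}$ with parameters $t_n=A_n^2$ and limiting function $$\psi(z)=\begin{cases} e^{-\frac{z^4}{12}\kappa_4}, & q\ge 2,\\ 1, & 1<q<2.\end{cases}$$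
   Context: Walsh functions: let $r_0(x)=1$ for $0\le x<\frac12$, $r_0(x)=-1$ for $\frac12\le x<1$, extended to $\mathbb{R}$ with period $1$, and let $r_n(x)=r_0(2^nx)$, $n\ge 0$, be the Rademacher functions. If $n=\sum_{i\ge 0}k_i2^i$ with $k_i\in\{0,1\}$ is the dyadic expansion of $n$ and $l_1,\dots,l_m$ are the indices $i$ with $k_i=1$, then $W_n(x)=\prod_{i=1}^m r_{l_i}(x)$. Mod-Gaussian convergence: for $-\infty\le c<0<d\le\infty$ let $S_{(c,d)}=\{z\in\mathbb{C}: c<\operatorname{Re} z<d\}$ (so $S_{(-\infty,\infty)}=\mathbb{C}$). A sequence $(X_n)$ of real random variables whose moment generating functions $\varphi_n(z)=\mathbb{E}[e^{zX_n}]$ exist on $S_{(c,d)}$ converges mod-Gaussian on $S_{(c,d)}$ with parameters $(t_n)$, $t_n\to\infty$, and limiting function $\psi$, if $\psi$ is analytic on $S_{(c,d)}$, does not vanish on the real part of $S_{(c,d)}$, and $\lim_{n\to\infty}\varphi_n(z)e^{-t_nz^2/2}=\psi(z)$ locally uniformly on $S_{(c,d)}$. *)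

(* Defs.v *)
From HB Require Import structures.
From mathcomp Require Import all_boot all_order all_algebra.
From mathcomp Require Import all_classical all_reals all_analysis.
From mathcomp Require Import measurable_realfun complex.

Set Implicit Arguments.
Unset Strict Implicit.
Unset Printing Implicit Defensive.

Import Order.TTheory GRing.Theory Num.Theory numFieldNormedType.Exports.

Local Open Scope classical_set_scope.
Local Open Scope ring_scope.
Local Open Scope complex_scope.

(* The topological and normed structure of the complex plane is the canonical
   one of the numFieldType R[i], carried by its regular copy R[i]^o. *)

Definition cexp (R : realType) (z : R[i]) : R[i] :=
  (expR (complex.Re z) * cos (complex.Im z)) +i*
  (expR (complex.Re z) * sin (complex.Im z)).

Definition strip (R : realType) (c d : \bar R) : set R[i]^o :=
  [set z | (c < (complex.Re z)%:E)%E /\ ((complex.Re z)%:E < d)%E].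

(* [derivable] over the scalar field R[i], in the direction 1, is complex
   differentiability at a point. *)
Definition analytic_on (R : realType) (A : set R[i]^o)
    (f : R[i]^o -> R[i]^o) : Prop :=
  forall z, A z -> derivable f z 1.

Definition cvg_locally_uniformly (R : realType) (A : set R[i]^o)
    (f : nat -> R[i]^o -> R[i]^o) (g : R[i]^o -> R[i]^o) : Prop :=
  forall z, A z -> exists2 U : set R[i]^o,
    nbhs z U & {uniform U `&` A, f @ \oo --> g}.

Definition cexpectation d (T : measurableType d) (R : realType)
    (P : probability T R) (f : T -> R[i]) : R[i] :=
  fine 'E_P[fun w => complex.Re (f w)] +i* fine 'E_P[fun w => complex.Im (f w)].

Definition cintegrable d (T : measurableType d) (R : realType)
    (P : probability T R) (f : T -> R[i]) : Prop :=
  P.-integrable setT (fun w => (complex.Re (f w))%:E) /\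
  P.-integrable setT (fun w => (complex.Im (f w))%:E).

Definition cmgf d (T : measurableType d) (R : realType)
    (P : probability T R) (X : T -> R) (z : R[i]) : R[i] :=
  cexpectation P (fun w => cexp (z * (X w)%:C)).

Definition cmgf_exists d (T : measurableType d) (R : realType)
    (P : probability T R) (X : T -> R) (z : R[i]) : Prop :=
  cintegrable P (fun w => cexp (z * (X w)%:C)).

Definition mod_gaussian_cvg d (T : measurableType d) (R : realType)
    (P : probability T R) (X : nat -> {RV P >-> R}) (c e : \bar R)
    (t : nat -> R) (psi : R[i] -> R[i]) : Prop :=
  (c < 0)%E /\ (0 < e)%E /\
  (forall n z, strip c e z -> cmgf_exists P (X n) z) /\
  (t @ \oo --> +oo) /\
  analytic_on (strip c e) psi /\
  (forall x : R, strip c e x%:C -> psi x%:C != 0) /\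
  cvg_locally_uniformly (strip c e)
    (fun n z => cmgf P (X n) z * cexp (- ((t n)%:C * z ^+ 2 / 2))) psi.

Definition unit_interval_prob (R : realType) :
    set (measurableTypeR R) -> \bar R :=
  mrestr lebesgue_measure (measurable_itv `[0 : R, 1]).

HB.instance Definition _ (R : realType) := 
  Measure.copy (@unit_interval_prob R)
    (mrestr lebesgue_measure (measurable_itv `[0 : R, 1])).

Lemma unit_interval_prob_setT (R : realType) :
  @unit_interval_prob R setT = 1%E.
Proof.
by rewrite /unit_interval_prob /mrestr setTI lebesgue_measure_itv/= lte_fin
  ltr01 -EFinB subr0.
Qed.

HB.instance Definition _ (R : realType) :=
  Measure_isProbability.Build _ _ _ (@unit_interval_prob R)
    (@unit_interval_prob_setT R).

Definition rademacher0 (R : realType) (x : R) : R :=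
  if x - (Num.floor x)%:~R < 2^-1 then 1 else -1.

Definition rademacher (R : realType) (n : nat) (x : R) : R :=
  rademacher0 (2 ^+ n * x).

(* The i-th binary digit of n is [odd (n %/ 2 ^ i)]; it vanishes for i >= n,
   since n < 2 ^ n. *)
Definition walsh (R : realType) (n : nat) (x : R) : R :=
  \prod_(i < n | odd (n %/ 2 ^ i)) rademacher i x.

Definition walsh_sum (R : realType) (m : nat -> nat) (a : nat -> nat -> R)
    (n : nat) (x : measurableTypeR R) : R :=
  \sum_(1 <= k < n.+1) a k n * walsh (m k) x.

Lemma measurable_rademacher0 (R : realType) :
  measurable_fun setT (@rademacher0 R).
Proof.
apply: measurable_fun_if => //; apply: measurable_fun_ltr => //.
apply: measurable_funB => //; apply: nondecreasing_measurable => // x y xy.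
by rewrite ler_int le_floor.
Qed.

Lemma measurable_rademacher (R : realType) n :
  measurable_fun setT (@rademacher R n).
Proof.
apply: (measurableT_comp (@measurable_rademacher0 R)).
exact: measurable_funM.
Qed.

Lemma measurable_walsh (R : realType) n : measurable_fun setT (@walsh R n).
Proof.
rewrite (_ : @walsh R n = fun x =>
  \prod_(i < n) (if odd (n %/ 2 ^ i) then rademacher i x else 1)); last first.
  by apply/funext => x; rewrite /walsh big_mkcond.
apply: measurable_prod => i _; case: odd => //; exact: measurable_rademacher.
Qed.

Lemma measurable_walsh_sum (R : realType) m a n :
  measurable_fun setT (@walsh_sum R m a n).
Proof.
apply: measurable_sum => k; apply: measurable_funM => //.
exact: measurable_walsh.
Qed.

HB.instance Definition _ (R : realType) m a n :=
  isMeasurableFun.Build _ _ _ _ (@walsh_sum R m a n)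
    (measurable_walsh_sum m a n).

Definition array_norm (R : realType) (a : nat -> nat -> R) (n : nat) : R :=
  Num.sqrt (\sum_(1 <= k < n.+1) a k n ^+ 2).

(* The absolute values are nonnegative, so the neutral element 0 does not affect
   the maximum for n >= 1. *)
Definition array_max (R : realType) (a : nat -> nat -> R) (n : nat) : R :=
  \big[Num.max/0]_(1 <= k < n.+1) `|a k n|.

(* Main.v *)
Require Import Defs.
From mathcomp Require Import all_boot all_order all_algebra.
From mathcomp Require Import all_classical all_reals all_analysis.
From mathcomp Require Import measurable_realfun complex.
From mathcomp Require Import zify ring lra.
Import Order.TTheory GRing.Theory Num.Theory numFieldNormedType.Exports.
Local Open Scope classical_set_scope.
Local Open Scope ring_scope.
Local Open Scope complex_scope.

Set Implicit Arguments.
Unset Strict Implicit.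
Unset Printing Implicit Defensive.

(** A Walsh function takes the values 1 and -1 only, so with [t_k] the hyperbolic
    tangent of [a_k z],
      [E e^(zS) = prod_k cosh(a_k z) * E prod_k (1 + t_k W_(m_k))].
    The two factors are treated separately.

    The first one, multiplied by the Gaussian normalisation, is compared factor by
    factor with [prod_k e^(-(a_k z)^4/12)], since
    [cosh w * e^(-w^2/2) = e^(-w^4/12) + O(|w|^6)] ([ccosh_gauss_quartic]). The
    total error is of order [n d_n^6], and the comparison product converges because
    [sum_k a_k^4] does.

    The second one tends to 1. Expanding the product over sets of indices, every
    product of Walsh functions is again a Walsh function, whose mean is 0 or 1.
    Hence the distance of the second factor from 1 is at most that of the mean of
    the Riesz product [P_n = prod_k (1 + tau W_(m_k))], where [tau] bounds all
    [|t_k|] and is of order [d_n] ([cmgf_char_sum_le]).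

    For [q >= 2] each [W_(m_k)] contains a Rademacher function that occurs in none
    of the previous ones, and the mean of [P_n] is exactly 1
    ([riesz_mass_dyadic]). For [1 < q < 2] the increment is
    [E P_(k+1) - E P_k = tau * E (P_k W_(m_k))]. The last mean collects the
    relations between characters with largest index [k]. The next index [l] in such
    a relation must be within a bounded distance of [k], because the leading binary
    digit of [m_k] has to be cancelled. The residual [m_k xor m_l] is at least
    [m_k - m_l], which is a fixed proportion of [m_k], so the third index is within
    a bounded distance of [k] as well. What remains is a Fourier coefficient of the
    nonnegative function [P_i] with [i < k], and such a coefficient is at most
    [E P_i <= E P_k]. Therefore [E P_(k+1) <= (1 + C tau^3) * E P_k]
    ([riesz_mass_step]), so that [1 <= E P_n <= exp (C n tau^3)], and [n d_n^3]
    tends to 0. *)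

(** * Modulus of complex numbers *)

Section Modulus.
Context {R : realType}.
Implicit Types (x y z : R[i]).

(** The norm of [R[i]] takes its values in [R[i]]; estimates that rely on a total
    order need its real counterpart. *)
Definition cmod (z : R[i]) : R := complex.Re `|z|.

Lemma cmodE z : `|z| = (cmod z)%:C.
Proof. by rewrite /cmod normc_def. Qed.

Lemma cmod_ge0 z : 0 <= cmod z.
Proof. by rewrite /cmod normc_def /= sqrtr_ge0. Qed.

Lemma cmodM x y : cmod (x * y) = cmod x * cmod y.
Proof. by apply: (@complexI R); rewrite rmorphM /= -!cmodE normrM. Qed.

Lemma cmodX x n : cmod (x ^+ n) = cmod x ^+ n.
Proof. by apply: (@complexI R); rewrite rmorphXn /= -!cmodE normrX. Qed.

Lemma cmodN x : cmod (- x) = cmod x.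
Proof. by rewrite /cmod normrN. Qed.

Lemma cmod0 : cmod 0 = 0.
Proof. by rewrite /cmod normr0. Qed.

Lemma cmod1 : cmod 1 = 1.
Proof. by rewrite /cmod normr1. Qed.

Lemma cmodV x : cmod x^-1 = (cmod x)^-1.
Proof. by apply: (@complexI R); rewrite fmorphV /= -!cmodE normfV. Qed.

Lemma cmodD x y : cmod (x + y) <= cmod x + cmod y.
Proof. by rewrite -lecR rmorphD /= -!cmodE ler_normD. Qed.

Lemma cmodBD x y : cmod (x - y) <= cmod x + cmod y.
Proof. by rewrite -[cmod y]cmodN cmodD. Qed.

Lemma cmodR (r : R) : cmod r%:C = `|r|.
Proof. by rewrite /cmod normc_def /= expr0n addr0 sqrtr_sqr. Qed.

Lemma cmod_nat n : cmod n%:R = n%:R.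
Proof. by rewrite /cmod normr_nat -(rmorph_nat (real_complex R)). Qed.

Lemma Re_le_cmod x : `|complex.Re x| <= cmod x.
Proof. by rewrite -lecR -cmodE normc_ge_Re. Qed.

Lemma cmod_eq0 x : (cmod x == 0) = (x == 0).
Proof. by rewrite -(normr_eq0 x) cmodE -(inj_eq (@complexI R)). Qed.

Lemma cmod_sum (I : Type) (r : seq I) (Q : pred I) (F : I -> R[i]) :
  cmod (\sum_(i <- r | Q i) F i) <= \sum_(i <- r | Q i) cmod (F i).
Proof.
apply: (big_ind2 (fun a b => cmod a <= b)) => //; first by rewrite cmod0.
by move=> *; apply: le_trans (cmodD _ _) _; apply: lerD.
Qed.

Lemma ReZ (r : R) x : complex.Re (r%:C * x) = r * complex.Re x.
Proof. by case: x => a b /=; rewrite mul0r subr0. Qed.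

(** Pairing a complex number with the conjugate of its own direction recovers
    its modulus as a real part, which reduces bounds on vector-valued increments
    to the scalar mean value theorem. *)
Lemma cmod_dual x : exists2 u, cmod u = 1 & cmod x = complex.Re (u * x).
Proof.
have [->|x0] := eqVneq x 0.
  by exists 1; rewrite ?cmod1 // mulr0 cmod0.
exists (`|x| / x).
  rewrite cmodM cmodV cmodE cmodR ger0_norm ?cmod_ge0 // divff //.
  by rewrite cmod_eq0.
by rewrite mulfVK // /cmod.
Qed.

End Modulus.

(** * Taylor expansion of the complex exponential *)

Section ComplexExp.
Context {R : realType}.
Implicit Types (x y z w : R[i]) (s : R).

Lemma cexpD x y : cexp (x + y) = cexp x * cexp y.
Proof.
case: x y => [a b] [c d]; rewrite /cexp /= expRD cosD sinD.
by apply/eqP; rewrite eq_complex /=; apply/andP; split; apply/eqP; ring.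
Qed.

Lemma cexp0 : cexp (0 : R[i]) = 1.
Proof. by rewrite /cexp /= expR0 cos0 sin0 mulr1 mulr0. Qed.

Lemma cmod_cexp z : cmod (cexp z) = expR (complex.Re z).
Proof.
rewrite /cmod normc_def /= !exprMn -mulrDr cos2Dsin2 mulr1 sqrtr_sqr.
by rewrite ger0_norm ?expR_ge0.
Qed.

Lemma cexp_neq0 z : cexp z != 0.
Proof. by rewrite -cmod_eq0 cmod_cexp gt_eqF ?expR_gt0. Qed.

Lemma cmod_cexp_le z : cmod (cexp z) <= expR (cmod z).
Proof.
by rewrite cmod_cexp ler_expR (le_trans (ler_norm _)) // Re_le_cmod.
Qed.

Lemma cexp_sum n (F : 'I_n -> R[i]) : cexp (\sum_i F i) = \prod_i cexp (F i).
Proof. by apply: (big_morph _ cexpD cexp0). Qed.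

(** Differentiability of a path in the plane, tested against all real-linear
    functionals: this is the form in which the mean value theorem applies. *)
Definition path_deriv (f g : R -> R[i]) : Prop := forall (u : R[i]) s,
  is_derive s 1 (fun s => complex.Re (u * f s)) (complex.Re (u * g s)).

Lemma path_increment (f g : R -> R[i]) (M : R) :
  path_deriv f g -> (forall s, 0 <= s <= 1 -> cmod (g s) <= M) ->
  cmod (f 1 - f 0) <= M.
Proof.
move=> dfg gM.
have [u u1 ->] := cmod_dual (f 1 - f 0).
have [||c] := @MVT_segment R (fun s => complex.Re (u * f s))
  (fun s => complex.Re (u * g s)) 0 1 ler01.
- by move=> s _; apply: dfg.
- apply: continuous_subspaceT => s.
  have [ds _] := dfg u s.
  exact/differentiable_continuous/derivable1_diffP.
rewrite subr0 mulr1 => c01 e.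
have -> : complex.Re (u * (f 1 - f 0)) =
  complex.Re (u * f 1) - complex.Re (u * f 0).
  by case: (u) (f 1) (f 0) => a b [p p'] [r r'] /=; ring.
rewrite e (le_trans (ler_norm _)) // (le_trans (Re_le_cmod _)) //.
by rewrite cmodM u1 mul1r gM //; move: c01; rewrite in_itv.
Qed.

Lemma path_deriv_cexp w :
  path_deriv (fun s => cexp (s%:C * w)) (fun s => w * cexp (s%:C * w)).
Proof.
move=> u s; case: u w => [a b] [p r].
rewrite (_ : (fun s => _) = (fun s => expR (s * p)) *
    (fun s => a * cos (s * r) - b * sin (s * r))); last first.
  apply/funext => t; rewrite /cexp /=. rewrite !mul0r !subr0 !addr0.
  by rewrite fctE; ring.
have dl (c : R) : is_derive s 1 (fun t => t * c) c.
  rewrite (_ : (fun t => t * c) = c \*: id); last first.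
    by apply/funext => t /=; rewrite mulrC.
  by apply: is_derive_eq; rewrite /GRing.scale /= mulr1.
have de : is_derive s 1 (fun t => expR (t * p)) (expR (s * p) * p).
  by apply: (is_derive1_comp (f := expR)).
have dc : is_derive s 1 (fun t => cos (t * r)) (- sin (s * r) * r).
  by apply: (is_derive1_comp (f := cos)).
have ds : is_derive s 1 (fun t => sin (t * r)) (cos (s * r) * r).
  by apply: (is_derive1_comp (f := sin)).
have dL : is_derive s 1 (fun t => a * cos (t * r) - b * sin (t * r))
   (a * (- sin (s * r) * r) - b * (cos (s * r) * r)).
  apply: is_deriveB.
apply: is_derive_eq.
rewrite /GRing.scale /cexp /= !mul0r !subr0 !addr0; ring.
Qed.

Definition cexp_taylor n w : R[i] := \sum_(k < n) w ^+ k / k`!%:R.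

Lemma path_deriv_taylor n w :
  path_deriv (fun s => cexp_taylor n.+1 (s%:C * w))
             (fun s => w * cexp_taylor n (s%:C * w)).
Proof.
move=> u s; elim: n => [|n IHn].
  rewrite [X in is_derive _ _ _ X](_ : _ = 0); last first.
    by rewrite /cexp_taylor big_ord0 !mulr0.
  under eq_fun => t do rewrite /cexp_taylor big_ord1 expr0.
  exact: is_derive_cst.
pose v := w ^+ n.+1 / (n.+1)`!%:R.
under eq_fun => t.
  rewrite /cexp_taylor big_ord_recr /= -/(cexp_taylor _ _) mulrDr raddfD /=.
  rewrite exprMn -rmorphXn /= -mulrA -/v mulrCA ReZ.
  over.
rewrite [X in is_derive _ _ _ X](_ : _ =
  complex.Re (u * (w * cexp_taylor n (s%:C * w)))
   + complex.Re (u * v) * (n.+1%:R * s ^+ n)); last first.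
  rewrite /cexp_taylor big_ord_recr /= 2!mulrDr raddfD /=; congr (_ + _).
  rewrite exprMn -rmorphXn /=.
  have -> : u * (w * ((s ^+ n)%:C * w ^+ n / n`!%:R)) =
     (n.+1%:R * s ^+ n)%:C * (u * v).
    rewrite /v factS natrM exprS rmorphM /= rmorph_nat.
    have h1 : n.+1%:R != 0 :> R[i] by rewrite pnatr_eq0.
    have h2 : n`!%:R != 0 :> R[i] by rewrite pnatr_eq0 -lt0n fact_gt0.
    by field; rewrite h2 /= nat1r.
  by rewrite ReZ mulrC.
have dX : is_derive s 1 (fun t => t ^+ n.+1 * complex.Re (u * v))
    (complex.Re (u * v) * (n.+1%:R * s ^+ n)).
  rewrite (_ : (fun t => _) = complex.Re (u * v) \*: (id ^+ n.+1)).
    by apply: is_derive_eq; rewrite /GRing.scale /= mulr1.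
  by apply/funext => t; rewrite fctE /GRing.scale /= mulrC.
exact: is_deriveD IHn dX.
Qed.

Lemma cexp_taylor0 n : cexp_taylor n.+1 0 = 1.
Proof.
rewrite /cexp_taylor big_ord_recl big1 ?addr0 ?expr0 ?divr1 // => i _.
by rewrite expr0n /= mul0r.
Qed.

(** Differentiating the remainder along the segment from 0 to [w] multiplies it
    by [w] and lowers its order, so that each order gains one factor [cmod w]. *)
Lemma cexp_taylor_le n w :
  cmod (cexp w - cexp_taylor n w) <= expR (cmod w) * cmod w ^+ n.
Proof.
elim: n w => [|n IHn] w.
  by rewrite /cexp_taylor big_ord0 subr0 mulr1 cmod_cexp_le.
have := @path_increment (fun s => cexp (s%:C * w) - cexp_taylor n.+1 (s%:C * w))
  (fun s => w * (cexp (s%:C * w) - cexp_taylor n (s%:C * w)))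
  (expR (cmod w) * cmod w ^+ n.+1).
rewrite !mul1r !mul0r cexp0 cexp_taylor0 subrr subr0; apply.
- move=> u s.
  under eq_fun do rewrite mulrBr raddfB.
  rewrite 2!mulrBr raddfB; apply: is_deriveB.
    exact: path_deriv_cexp.
  exact: path_deriv_taylor.
- move=> s /andP[s0 s1]; rewrite cmodM exprS mulrCA.
  apply: ler_wpM2l; first exact: cmod_ge0.
  apply: le_trans (IHn _) _.
  have h : cmod (s%:C * w) <= cmod w.
    by rewrite cmodM cmodR ger0_norm // ler_piMl // cmod_ge0.
  apply: ler_pM; rewrite ?expR_ge0 ?exprn_ge0 ?cmod_ge0 ?ler_expR //.
  by apply: lerXn2r; rewrite ?nnegrE ?cmod_ge0.
Qed.

End ComplexExp.

(** * Complex differentiability of the exponential *)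

Section CexpDerivable.
Context {R : realType}.

(** The difference quotient at [z] is [cexp z] times that at 0, whose error is the
    second-order Taylor remainder. *)
Lemma cexp_taylor_quotient (z h : R[i]) : h != 0 -> cmod h <= 1 ->
  cmod (cexp z - h^-1 * (cexp (h + z) - cexp z))
    <= cmod (cexp z) * expR 1 * cmod h.
Proof.
move=> h0 h1; have := cexp_taylor_le 2 h.
have -> : cexp z - h^-1 * (cexp (h + z) - cexp z) =
  - (cexp z * h^-1 * (cexp h - cexp_taylor 2 h)).
  rewrite cexpD /cexp_taylor !big_ord_recr big_ord0 /= expr0 expr1 !divr1.
  by field.
have m0 : 0 < cmod h by rewrite lt0r cmod_eq0 h0 cmod_ge0.
move=> le2; rewrite cmodN !cmodM cmodV -!mulrA ler_wpM2l ?cmod_ge0 //.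
rewrite ler_pdivrMl // (le_trans le2) //.
rewrite expr2 mulrCA ler_wpM2l ?cmod_ge0 // ler_wpM2r ?cmod_ge0 //.
by rewrite ler_expR.
Qed.

Lemma derivable_cexp (z : R[i]^o) : derivable (@cexp R : R[i]^o -> R[i]^o) z 1.
Proof.
apply/cvg_ex; exists (cexp z : R[i]^o); apply/cvgrPdist_le => e e0.
pose K := (cmod (cexp z) * expR 1)%:C.
have K0 : 0 < K.
  rewrite /K -[X in X < _]/((0 : R)%:C) ltcR mulr_gt0 ?expR_gt0 //.
  by rewrite cmod_cexp expR_gt0.
near=> h.
have h0 : h != 0 by near: h; exact: nbhs_dnbhs_neq.
have h1 : `|h| <= 1 by near: h; apply: dnbhs0_le.
have hK : `|h| <= e / K by near: h; apply: dnbhs0_le; rewrite divr_gt0.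
rewrite /GRing.scale /= mulr1.
apply: le_trans (_ : K * `|h| <= _).
  by rewrite !cmodE /K -rmorphM lecR cexp_taylor_quotient // -lecR -cmodE.
by rewrite mulrC -ler_pdivlMr.
Unshelve. all: by end_near. Qed.

Lemma derivable_cexp_comp (f : R[i]^o -> R[i]^o) (z : R[i]^o) :
  derivable f z 1 -> derivable (fun z => cexp (f z) : R[i]^o) z 1.
Proof.
move=> /derivable1_diffP df; apply/derivable1_diffP.
have /derivable1_diffP dg := @derivable_cexp (f z).
exact: (differentiable_comp df dg).
Qed.

Lemma derivable_cexp_quartic (c : R) (z : R[i]^o) :
  derivable (fun z : R[i]^o => cexp (- (z ^+ 4 / 12 * c%:C)) : R[i]^o) z 1.
Proof.
apply: derivable_cexp_comp.
rewrite (_ : (fun z => _) = ((- c%:C / 12) : R[i]^o) \*: (id ^+ 4)).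
  by apply: derivableZ; apply: derivableX; exact: derivable_id.
apply/funext => w; rewrite fctE.
by transitivity ((- c%:C / 12) * (w : R[i]) ^+ 4 : R[i]); first field.
Qed.

End CexpDerivable.

(** * The Gaussian-normalised hyperbolic cosine *)

Section LocalEstimate.
Context {R : realType}.
Implicit Types (w : R[i]).

Definition ccosh w : R[i] := (cexp w + cexp (- w)) / 2.
Definition csinh w : R[i] := (cexp w - cexp (- w)) / 2.

Lemma cmod_half w : cmod (w / 2) = cmod w / 2.
Proof. by rewrite cmodM cmodV cmod_nat. Qed.

Lemma ccosh_taylor w : cmod w <= 1 ->
  cmod (ccosh w - (1 + w ^+ 2 / 2 + w ^+ 4 / 24)) <= expR 1 * cmod w ^+ 6.
Proof.
move=> w1.
have -> : ccosh w - (1 + w ^+ 2 / 2 + w ^+ 4 / 24) =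
  ((cexp w - cexp_taylor 6 w) + (cexp (- w) - cexp_taylor 6 (- w))) / 2.
  rewrite /ccosh /cexp_taylor !big_ord_recr !big_ord0 /= !factS fact0 !natrM.
  by field.
rewrite cmod_half ler_pdivrMr // (le_trans (cmodD _ _)) // mulr_natr mulr2n.
have e1 : expR (cmod w) * cmod w ^+ 6 <= expR 1 * cmod w ^+ 6.
  by rewrite ler_wpM2r ?exprn_ge0 ?cmod_ge0 // ler_expR.
apply: lerD; apply: le_trans e1; first exact: cexp_taylor_le.
by have := cexp_taylor_le 6 (- w); rewrite cmodN.
Qed.

Lemma cexp_near1 w : cmod w <= 1 -> cmod (cexp w - 1) <= expR 1 * cmod w.
Proof.
move=> w1; have := cexp_taylor_le 1 w.
rewrite /cexp_taylor big_ord1 expr0 divr1 expr1 => /le_trans -> //.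
by rewrite ler_wpM2r ?cmod_ge0 // ler_expR.
Qed.

Lemma ccosh_near1 w : cmod w <= 1 -> cmod (ccosh w - 1) <= expR 1 * cmod w.
Proof.
move=> w1; have -> : ccosh w - 1 = ((cexp w - 1) + (cexp (- w) - 1)) / 2.
  by rewrite /ccosh; field.
rewrite cmod_half ler_pdivrMr // (le_trans (cmodD _ _)) // mulr_natr mulr2n.
apply: lerD; first exact: cexp_near1.
by have := @cexp_near1 (- w); rewrite cmodN; apply.
Qed.

Lemma csinh_le w : cmod w <= 1 -> cmod (csinh w) <= expR 1 * cmod w.
Proof.
move=> w1; have -> : csinh w = ((cexp w - 1) - (cexp (- w) - 1)) / 2.
  by rewrite /csinh; field.
rewrite cmod_half ler_pdivrMr // (le_trans (cmodBD _ _)) // mulr_natr mulr2n.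
apply: lerD; first exact: cexp_near1.
by have := @cexp_near1 (- w); rewrite cmodN; apply.
Qed.

Lemma cmod_ccosh_ge w : expR 1 * cmod w <= 2^-1 -> cmod w <= 1 ->
  2^-1 <= cmod (ccosh w).
Proof.
move=> ew w1; have := cmodBD (ccosh w) (ccosh w - 1).
rewrite opprB addrC subrK cmod1 => h.
have := ccosh_near1 w1; lra.
Qed.

Lemma ctanh_le w : expR 1 * cmod w <= 2^-1 -> cmod w <= 1 ->
  cmod (csinh w / ccosh w) <= 2 * expR 1 * cmod w.
Proof.
move=> ew w1; have c2 := cmod_ccosh_ge ew w1.
rewrite cmodM cmodV ler_pdivrMr; last by lra.
have s2 := csinh_le w1.
have p : 0 <= expR 1 * cmod w by rewrite mulr_ge0 ?expR_ge0 ?cmod_ge0.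
rewrite -mulrA; nra.
Qed.

(** The constants cancel because [log (cosh w) = w^2/2 - w^4/12 + O(w^6)]; here
    this is checked on the Taylor polynomials of the three exponentials. *)
Lemma ccosh_gauss_quartic : exists2 K : R, 0 <= K & forall w, cmod w <= 1 ->
  cmod (ccosh w * cexp (- (w ^+ 2 / 2)) - cexp (- (w ^+ 4 / 12)))
    <= K * cmod w ^+ 6.
Proof.
have e1 : (1 : R) <= expR 1 by rewrite -expR0 ler_expR.
set e := expR 1 in e1 *.
exists (1 + 3 * e + e * e); first by nra.
move=> w w1.
pose A := 1 + w ^+ 2 / 2 + w ^+ 4 / 24.
pose B := 1 - w ^+ 2 / 2 + w ^+ 4 / 8.
set u := cexp (- (w ^+ 2 / 2)); set v := cexp _.
have w0 := cmod_ge0 w.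
have wn n : cmod w ^+ n <= 1 by rewrite exprn_ile1.
have c2 : cmod (- (w ^+ 2 / 2)) = cmod w ^+ 2 / 2.
  by rewrite cmodN cmod_half cmodX.
have c4 : cmod (- (w ^+ 4 / 12)) = cmod w ^+ 4 / 12.
  by rewrite cmodN cmodM cmodX cmodV cmod_nat.
have w6 : 0 <= cmod w ^+ 6 by rewrite exprn_ge0.
have ew a : cmod a <= 1 -> expR (cmod a) <= e by rewrite ler_expR.
have ru : cmod (u - B) <= e * cmod w ^+ 6.
  have -> : B = cexp_taylor 3 (- (w ^+ 2 / 2)).
    rewrite /B /cexp_taylor !big_ord_recr big_ord0 /= !factS fact0 !natrM.
    by field.
  apply: le_trans (cexp_taylor_le _ _) _; apply: ler_pM; rewrite ?expR_ge0 //.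
  - by rewrite exprn_ge0 ?cmod_ge0.
  - by apply: ew; rewrite c2; have := wn 2; lra.
  - rewrite c2 expr_div_n -exprM ler_pdivrMr; last by rewrite exprn_gt0.
    by rewrite ler_peMr // !exprS expr0; lra.
have rv : cmod (v - (1 - w ^+ 4 / 12)) <= e * cmod w ^+ 6.
  have -> : 1 - w ^+ 4 / 12 = cexp_taylor 2 (- (w ^+ 4 / 12)).
    rewrite /cexp_taylor !big_ord_recr big_ord0 /= !factS fact0 !natrM.
    by field.
  apply: le_trans (cexp_taylor_le _ _) _; apply: ler_pM; rewrite ?expR_ge0 //.
  - by rewrite exprn_ge0 ?cmod_ge0.
  - by apply: ew; rewrite c4; have := wn 4; lra.
  - rewrite c4 expr_div_n -exprM (exprD _ 6 2).
    rewrite ler_pdivrMr; last by rewrite exprn_gt0.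
    by apply: ler_wpM2l => //; apply: le_trans (wn 2) _; rewrite expr2; lra.
have ub : cmod u <= e.
  by apply: le_trans (cmod_cexp_le _) (ew _ _); rewrite c2; have := wn 2; lra.
have Ab : cmod A <= 2.
  apply: le_trans (cmodD _ _) _.
  have := cmodD 1 (w ^+ 2 / 2).
  rewrite cmod1 cmod_half (cmodM (w ^+ 4)) cmodV cmod_nat !cmodX.
  have := wn 2; have := wn 4; lra.
have cmod_wn n k : cmod (w ^+ n / k%:R) = cmod w ^+ n / k%:R.
  by rewrite cmodM cmodV cmod_nat cmodX.
have rA := ccosh_taylor w1; rewrite -/A -/e in rA.
(* [A * B - (1 - w^4/12)] equals [w^6/24 + w^8/192]: the terms in [w^2] cancel, and
   those in [w^4] leave [1/24 + 1/8 - 1/4 = -1/12]. *)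
have -> : ccosh w * u - v = w ^+ 6 / 24 + w ^+ 8 / 192 + A * (u - B)
    + (ccosh w - A) * u - (v - (1 - w ^+ 4 / 12)).
  by rewrite /A /B; field.
apply: le_trans (cmodBD _ _) _.
apply: le_trans (lerD (cmodD _ _) (lexx _)) _.
apply: le_trans (lerD (lerD (cmodD _ _) (lexx _)) (lexx _)) _.
apply: le_trans (lerD (lerD (lerD (cmodD _ _) (lexx _)) (lexx _)) (lexx _)) _.
rewrite !cmod_wn (cmodM A) (cmodM (ccosh w - A)).
have w8 : cmod w ^+ 8 <= cmod w ^+ 6.
  by rewrite (exprD _ 6 2) ler_piMr.
have t1 : cmod A * cmod (u - B) <= 2 * (e * cmod w ^+ 6).
  by apply: ler_pM; rewrite ?cmod_ge0.
have t2 : cmod (ccosh w - A) * cmod u <= e * cmod w ^+ 6 * e.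
  by apply: ler_pM; rewrite ?cmod_ge0.
nra.
Qed.

End LocalEstimate.

(** * Comparison of products *)

Section ProductComparison.
Context {R : realType}.

(** Replacing the factors one at a time changes the product by one difference times
    factors bounded by the [M i]. *)
Lemma cmod_prod_sub (n : nat) (u v : 'I_n -> R[i]) (M : 'I_n -> R) :
  (forall i, 1 <= M i) ->
  (forall i, cmod (u i) <= M i) -> (forall i, cmod (v i) <= M i) ->
  cmod (\prod_i u i - \prod_i v i) <=
    (\sum_i cmod (u i - v i)) * \prod_i M i.
Proof.
elim: n u v M => [|n IHn] u v M M1 uM vM.
  by rewrite !big_ord0 subrr cmod0 mul0r.
rewrite !big_ord_recl.
set U := \prod_(i < n) _; set V := \prod_(i < n) _; set P := \prod_(i < n) _.
have P1 : 1 <= P.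
  by apply: (big_ind (fun a => 1 <= a)) => // *; exact: mulr_ege1.
have Ub : cmod V <= P.
  rewrite /V /P; apply: (big_ind2 (fun a b => cmod a <= b)); rewrite ?cmod1 //.
  by move=> *; rewrite cmodM; apply: ler_pM; rewrite ?cmod_ge0.
have -> : u ord0 * U - v ord0 * V =
  u ord0 * (U - V) + (u ord0 - v ord0) * V by ring.
apply: le_trans (cmodD _ _) _; rewrite !cmodM.
have {}IHn := IHn (fun i => u (lift ord0 i)) (fun i => v (lift ord0 i)) _
  (fun i => M1 (lift ord0 i)) (fun i => uM _) (fun i => vM _).
rewrite -/U -/V -/P in IHn; set S := \sum_(i < n) _ in IHn *.
have S0 : 0 <= S by apply: sumr_ge0 => i _; exact: cmod_ge0.
have a1 : cmod (u ord0) * cmod (U - V) <= M ord0 * (S * P).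
  by apply: ler_pM; rewrite ?cmod_ge0.
have a2 : cmod (u ord0 - v ord0) * cmod V <=
    cmod (u ord0 - v ord0) * (M ord0 * P).
  apply: ler_wpM2l; rewrite ?cmod_ge0 //; apply: le_trans Ub _.
  by rewrite ler_peMl //; lra.
rewrite addrC (le_trans (lerD a2 a1)) //.
by rewrite le_eqVlt; apply/orP; left; apply/eqP; ring.
Qed.

End ProductComparison.

(** * Means of bounded measurable functions on the unit interval *)

Section Mean.
Context {R : realType}.
Notation T := (measurableTypeR R).
Notation P := (@unit_interval_prob R).
Notation leb := (@lebesgue_measure R).
Implicit Types (f g : T -> R).

Definition mean f : R := fine 'E_P[f].

Definition bounded_measurable f : Prop :=
  measurable_fun setT f /\ exists M : R, forall x, `|f x| <= M.

Lemma bounded_measurable_bounded f (A : set T) :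
  bounded_measurable f -> [bounded f x | x in A].
Proof.
move=> [_ [M fM]]; exists M; split; first exact: num_real.
by move=> K MK x _; exact: le_trans (fM x) (ltW MK).
Qed.

Lemma bounded_measurable_integrable f :
  bounded_measurable f -> P.-integrable setT (EFin \o f).
Proof.
move=> bf; apply: measurable_bounded_integrable => //.
- by rewrite [ltLHS]probability_setT ltry.
- exact: bf.1.
- exact: bounded_measurable_bounded.
Qed.

Lemma bounded_measurable_cst (c : R) : bounded_measurable (fun=> c).
Proof. by split=> //; exists `|c|. Qed.

Lemma bounded_measurableD f g : bounded_measurable f -> bounded_measurable g ->
  bounded_measurable (fun x => f x + g x).
Proof.
move=> [mf [M fM]] [mg [N gN]]; split; first exact: measurable_funD.
by exists (M + N) => x; rewrite (le_trans (ler_normD _ _)) // lerD.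
Qed.

Lemma bounded_measurableM f g : bounded_measurable f -> bounded_measurable g ->
  bounded_measurable (fun x => f x * g x).
Proof.
move=> [mf [M fM]] [mg [N gN]]; split; first exact: measurable_funM.
by exists (M * N) => x; rewrite normrM ler_pM.
Qed.

Lemma bounded_measurable_sum (I : Type) (r : seq I) (F : I -> T -> R) :
  (forall i, bounded_measurable (F i)) ->
  bounded_measurable (fun x => \sum_(i <- r) F i x).
Proof.
move=> bF; elim: r => [|i r IHr].
  by under eq_fun do rewrite big_nil; exact: bounded_measurable_cst.
by under eq_fun do rewrite big_cons; exact: bounded_measurableD.
Qed.

Lemma bounded_measurable_prod (I : Type) (r : seq I) (F : I -> T -> R) :
  (forall i, bounded_measurable (F i)) ->
  bounded_measurable (fun x => \prod_(i <- r) F i x).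
Proof.
move=> bF; elim: r => [|i r IHr].
  by under eq_fun do rewrite big_nil; exact: bounded_measurable_cst.
by under eq_fun do rewrite big_cons; exact: bounded_measurableM.
Qed.

Lemma mean_cst (c : R) : mean (fun=> c) = c.
Proof. by rewrite /mean -/(cst c) expectation_cst. Qed.

Lemma meanD f g : bounded_measurable f -> bounded_measurable g ->
  mean (fun x => f x + g x) = mean f + mean g.
Proof.
move=> bf bg; rewrite /mean unlock.
by apply: RintegralD => //; exact: bounded_measurable_integrable.
Qed.

Lemma meanZ (c : R) f : bounded_measurable f ->
  mean (fun x => c * f x) = c * mean f.
Proof.
move=> bf; rewrite /mean unlock.
by apply: RintegralZl => //; exact: bounded_measurable_integrable.
Qed.

Lemma mean_sum (I : Type) (r : seq I) (F : I -> T -> R) :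
  (forall i, bounded_measurable (F i)) ->
  mean (fun x => \sum_(i <- r) F i x) = \sum_(i <- r) mean (F i).
Proof.
move=> bF; elim: r => [|i r IHr].
  by under eq_fun do rewrite big_nil; rewrite big_nil mean_cst.
under eq_fun do rewrite big_cons; rewrite big_cons meanD ?IHr //.
exact: bounded_measurable_sum.
Qed.

Lemma mean_le f g : bounded_measurable f -> bounded_measurable g ->
  (forall x, f x <= g x) -> mean f <= mean g.
Proof.
move=> bf bg fg; rewrite /mean unlock.
by apply: le_Rintegral => //; exact: bounded_measurable_integrable.
Qed.

Lemma lebesgue_integrable_itv f (a b : R) :
  bounded_measurable f -> leb.-integrable `[a, b[ (EFin \o f).
Proof.
move=> bf; apply: measurable_bounded_integrable => //.
- by rewrite /= lebesgue_measure_itv /=; case: ifP; rewrite ltry.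
- by apply: measurable_funS bf.1.
- exact: bounded_measurable_bounded.
Qed.

Lemma mean_lebesgue f : bounded_measurable f ->
  mean f = \int[leb]_(x in `[0, 1[) f x.
Proof.
move=> bf; rewrite /mean unlock /Rintegral; congr fine.
pose I : set T := `[0 : R, 1[%classic.
have mI : measurable I by exact: measurable_itv.
(* The endpoint 1 is dropped to make the period half-open. *)
have PI0 : P (~` I) = 0%E.
  rewrite /unit_interval_prob /mrestr.
  rewrite (_ : _ `&` _ = [set 1]); first exact: lebesgue_measure_set1.
  apply/seteqP; split => x; rewrite /I /= !in_itv /=.
    move=> [/negP + /andP[x0 x1]]; rewrite x0 /= -leNgt => x2.
    by apply/eqP; rewrite eq_le x1 x2.
  by move=> ->; rewrite ltxx ler01 lexx.
rewrite (negligible_integral (measurableC mI) measurableT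
  (bounded_measurable_integrable bf) PI0) setTD setCK.
apply: eq_measure_integral => A mA AI.
rewrite /unit_interval_prob /mrestr /=; congr (leb _).
by apply/setIidl => x /AI; rewrite /I /= !in_itv /= => /andP[-> /ltW].
Qed.

Lemma lebesgue_measure_translate (h : R) (A : set T) : measurable A ->
  pushforward leb (fun x : T => x + h : T) A = leb A.
Proof.
have mh : measurable_fun setT (fun x : T => x + h : T) by exact: measurable_funD.
move=> mA; apply/esym/lebesgue_measure_unique => //=.
move=> _ [[a b]] _ <-; rewrite /pushforward /=.
rewrite (_ : _ @^-1` _ = `]a - h, b - h]%classic); last first.
  by apply/seteqP; split => x /=; rewrite !in_itv /= ltrBlDr lerBrDr.
rewrite !lebesgue_measure_itv /= !lte_fin ltrD2r -!EFinB.
by congr (if _ then _ else _); congr EFin; ring.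
Qed.

Lemma integral_translate f (a b h : R) : bounded_measurable f ->
  \int[leb]_(x in `[a + h, b + h[) f x = \int[leb]_(x in `[a, b[) f (x + h).
Proof.
move=> bf; rewrite /Rintegral; congr fine.
have mh : measurable_fun setT (fun x : T => x + h : T) by exact: measurable_funD.
have e : (fun x : T => x + h : T) @^-1` `[a + h, b + h[ = `[a, b[%classic.
  by apply/seteqP; split => x /=; rewrite !in_itv /= lerD2r ltrD2r.
rewrite -{1}e -(integral_pushforward mh (f := EFin \o f)) //.
- by apply: eq_measure_integral => A mA _; exact/esym/lebesgue_measure_translate.
- by apply/measurable_EFinP; exact: bf.1.
- rewrite e; apply: (@lebesgue_integrable_itv (fun x => f (x + h))); split.
    by apply: measurableT_comp mh; exact: bf.1.
  by have [_ [M fM]] := bf; exists M.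
Qed.

(** Translating by [h] negates the integral over a period, and periodicity makes
    the integral over a period translation invariant. *)
Lemma mean_antiperiodic f (h : R) : bounded_measurable f -> 0 <= h <= 1 ->
  (forall x, f (x + 1) = f x) -> (forall x, f (x + h) = - f x) -> mean f = 0.
Proof.
move=> bf /andP[h0 h1] f1 fh; rewrite mean_lebesgue //.
pose I a b := \int[leb]_(x in `[a, b[) f x.
have Isplit a b c : a <= b -> b <= c -> I a c = I a b + I b c.
  move=> ab bc; rewrite /I (@itv_bndbnd_setU _ _ (BLeft a) (BLeft b) (BLeft c)) //.
  rewrite Rintegral_setU //.
  - rewrite -itv_bndbnd_setU //; exact: lebesgue_integrable_itv.
  - apply/disj_set2P; rewrite -subset0 => x /= [].
    rewrite !in_itv /= => /andP[_ xb] /andP[bx _].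
    by have := lt_le_trans xb bx; rewrite ltxx.
have Iper : I 1 (1 + h) = I 0 h.
  have -> : I 1 (1 + h) = \int[leb]_(x in `[0 + 1, h + 1[) f x.
    by rewrite /I add0r (addrC h).
  rewrite integral_translate //.
  by apply: eq_Rintegral => x _; rewrite f1.
have Ineg : I h (1 + h) = - I 0 1.
  have -> : I h (1 + h) = \int[leb]_(x in `[0 + h, 1 + h[) f x.
    by rewrite /I add0r.
  rewrite integral_translate //.
  under eq_Rintegral do rewrite fh -mulN1r.
  by rewrite RintegralZl ?mulN1r //; exact: lebesgue_integrable_itv.
have e1 := Isplit 0 h 1 h0 h1.
have e2 : I h (1 + h) = I h 1 + I 1 (1 + h) by apply: Isplit => //; lra.
rewrite -/(I 0 1); lra.
Qed.

End Mean.

(** * Rademacher functions *)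

Section Rademacher.
Context {R : realType}.

Lemma rademacher0_sqr (x : R) : rademacher0 x * rademacher0 x = 1.
Proof. by rewrite /rademacher0; case: ifP; rewrite ?mulrNN mulr1. Qed.

Lemma rademacher0_addn (x : R) n : rademacher0 (x + n%:R) = rademacher0 x.
Proof.
rewrite /rademacher0 floorDrz ?natr_int // intrD (@floorK _ n%:R) ?natr_int //.
by congr (if _ < _ then _ else _); ring.
Qed.

Lemma rademacher0_half (x : R) : rademacher0 (x + 2^-1) = - rademacher0 x.
Proof.
rewrite /rademacher0.
set u := Num.floor x.
have /andP[u1 u2] := floor_itv x; rewrite -/u in u1 u2.
rewrite intrD in u2.
have [h|h] := ltP (x - u%:~R) 2^-1.
  have -> : Num.floor (x + 2^-1) = u.
    by apply: floor_def; rewrite intrD; apply/andP; split; lra.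
  by rewrite ifF //; apply/negbTE; rewrite -leNgt; lra.
have -> : Num.floor (x + 2^-1) = (u + 1)%R.
  by apply: floor_def; rewrite !intrD; apply/andP; split; lra.
by rewrite ifT ?opprK // intrD; lra.
Qed.

Lemma rademacher_sqr i (x : R) : rademacher i x * rademacher i x = 1.
Proof. exact: rademacher0_sqr. Qed.

Lemma rademacher_period i (x : R) : rademacher i (x + 1) = rademacher i x.
Proof. by rewrite /rademacher mulrDr mulr1 -natrX rademacher0_addn. Qed.

Lemma rademacher_half_period i (x : R) :
  rademacher i (x + 2 ^- i.+1) = - rademacher i x.
Proof.
rewrite /rademacher -rademacher0_half; congr rademacher0.
rewrite mulrDr exprSr invfM mulrA divff ?mul1r //.
Qed.

Lemma rademacher_coarse_shift i l (x : R) : (l < i)%N ->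
  rademacher i (x + 2 ^- l.+1) = rademacher i x.
Proof.
move=> li; rewrite /rademacher mulrDr -(subnK li) exprD mulfK; last first.
  by rewrite expf_neq0 // pnatr_eq0.
by rewrite -exprD -[X in _ + X]natrX rademacher0_addn.
Qed.

Lemma bounded_measurable_rademacher i : bounded_measurable (@rademacher R i).
Proof.
split; first exact: measurable_rademacher.
exists 1 => x; rewrite /rademacher /rademacher0.
by case: ifP; rewrite ?normrN normr1.
Qed.

End Rademacher.

(** * Walsh characters *)

Section Character.
Context {R : realType}.
Variable N : nat.
Implicit Types (b c : nat -> bool) (x : R).

Definition bit (m i : nat) : bool := odd (m %/ 2 ^ i).

(** Characters are indexed by sequences of binary digits, so that their product
    corresponds to the digitwise exclusive or; only the digits below [N] count. *)
Definition walsh_char b x : R := \prod_(i < N | b i) rademacher i x.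

Lemma walsh_charM b c x :
  walsh_char b x * walsh_char c x = walsh_char (fun i => b i (+) c i) x.
Proof.
rewrite /walsh_char big_mkcond [X in _ * X]big_mkcond [RHS]big_mkcond.
rewrite -big_split; apply: eq_bigr => i _ /=.
by case: (b i); case: (c i); rewrite /= ?mulr1 ?mul1r ?rademacher_sqr.
Qed.

Lemma walsh_char_eq b c x : b =1 c -> walsh_char b x = walsh_char c x.
Proof. by move=> bc; apply: eq_bigl => i; rewrite bc. Qed.

Lemma walsh_char0 x : walsh_char (fun=> false) x = 1.
Proof. by rewrite /walsh_char big_pred0. Qed.

Lemma walsh_char_sqr b x : walsh_char b x * walsh_char b x = 1.
Proof.
rewrite walsh_charM -(walsh_char0 x).
by apply: walsh_char_eq => i; rewrite addbb.
Qed.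

Lemma walsh_char_pm1 b x : walsh_char b x = 1 \/ walsh_char b x = -1.
Proof.
have /eqP := walsh_char_sqr b x.
by rewrite -expr2 sqrf_eq1 => /orP[]/eqP; [left|right].
Qed.

Lemma walsh_char_norm b x : `|walsh_char b x| = 1.
Proof. by have [->|->] := walsh_char_pm1 b x; rewrite ?normrN normr1. Qed.

Lemma walshE m x : (m <= N)%N -> walsh m x = walsh_char (bit m) x.
Proof.
move=> mN; rewrite /walsh /walsh_char.
rewrite (big_ord_widen_cond _ (fun i => odd (m %/ 2 ^ i))
  (fun i => rademacher i x) mN).
apply: eq_bigl => i; rewrite /bit.
have [//|mi] := ltnP i m; first by rewrite andbT.
by rewrite andbF divn_small // (leq_ltn_trans mi) // ltn_expl.
Qed.

Lemma bounded_measurable_char b : bounded_measurable (walsh_char b).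
Proof.
rewrite (_ : walsh_char b =
  fun x => \prod_(i < N) (if b i then rademacher i x else 1)).
  apply: bounded_measurable_prod => i; case: (b i).
    exact: bounded_measurable_rademacher.
  exact: bounded_measurable_cst.
by apply/funext => x; rewrite /walsh_char big_mkcond.
Qed.

(** A shift by half a period of the coarsest Rademacher factor flips the sign of
    that factor and is a period of all the finer ones. *)
Lemma mean_char0 b i : (i < N)%N -> b i -> mean (walsh_char b) = 0.
Proof.
move=> iN bi; have exb : exists i, (i < N)%N && b i by exists i; rewrite iN.
case: (ex_minnP exb) => l /andP[lN bl] lmin.
apply: (@mean_antiperiodic _ _ (2 ^- l.+1)).
- exact: bounded_measurable_char.
- by rewrite invr_ge0 exprn_ge0 //= invf_le1 ?exprn_gt0 // exprn_ege1 // ler1n.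
- by move=> x; apply: eq_bigr => j _; rewrite rademacher_period.
- move=> x; rewrite /walsh_char (bigD1 (Ordinal lN)) //=.
  rewrite [in RHS](bigD1 (Ordinal lN)) //= rademacher_half_period mulNr.
  congr (- (_ * _)); apply: eq_bigr => j /andP[bj jl].
  apply: rademacher_coarse_shift; rewrite ltn_neqAle eq_sym jl /=.
  by apply: lmin; rewrite bj andbT.
Qed.

Lemma mean_char1 b : (forall i, (i < N)%N -> ~~ b i) -> mean (walsh_char b) = 1.
Proof.
move=> nb; rewrite -[RHS](mean_cst (R := R)); congr mean; apply/funext => x.
by rewrite /walsh_char big_pred0 // => i; apply/negbTE/nb.
Qed.

Lemma mean_char_ge0 b : 0 <= mean (walsh_char b).
Proof.
have [/existsP[i bi]|] := boolP [exists i : 'I_N, b i].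
  by rewrite (@mean_char0 _ i).
move=> /existsPn nb; rewrite mean_char1 // => i iN.
exact: (nb (Ordinal iN)).
Qed.

End Character.

(** * Leading binary digits *)

Lemma bit_small m t : (m < 2 ^ t)%N -> bit m t = false.
Proof. by move=> h; rewrite /bit divn_small. Qed.

Lemma bit_lt_size m t N : bit m t -> (m <= N)%N -> (t < N)%N.
Proof.
move=> bt mN; rewrite (leq_trans _ mN) //; rewrite ltnNge; apply/negP => mt.
by rewrite bit_small // in bt; rewrite (leq_ltn_trans mt) // ltn_expl.
Qed.

Lemma top_bit m : (0 < m)%N -> exists2 t, bit m t & (m < 2 ^ t.+1)%N.
Proof.
move=> m0; exists (trunc_log 2 m); last exact: trunc_log_ltn.
have /andP[l1 l2] := trunc_log_bounds (isT : (1 < 2)%N) m0.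
rewrite /bit; suff -> : (m %/ 2 ^ trunc_log 2 m = 1)%N by [].
apply/eqP; rewrite eqn_leq divn_gt0 ?expn_gt0 // l1 andbT -ltnS.
by rewrite ltn_divLR ?expn_gt0 // -expnS.
Qed.

(** The highest bit in which two integers differ controls their distance. *)
Lemma top_differing_bit m l : (l < m)%N ->
  exists2 t, bit m t (+) bit l t & (m - l < 2 ^ t.+1)%N.
Proof.
move=> lm.
have ex : exists t, (m %/ 2 ^ t == l %/ 2 ^ t)%N.
  have mlt : (m < 2 ^ m)%N by rewrite ltn_expl.
  by exists m; rewrite (divn_small mlt) (divn_small (ltn_trans lm mlt)) eqxx.
case: (ex_minnP ex) => -[|t]; rewrite ?expn0 ?divn1.
  by move=> /eqP e; rewrite e ltnn in lm.
move=> /eqP e tmin; exists t.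
  rewrite -negb_eqb /bit; apply/eqP => eo.
  suff /tmin : (m %/ 2 ^ t == l %/ 2 ^ t)%N by rewrite ltnn.
  rewrite (divn_eq (m %/ 2 ^ t) 2) (divn_eq (l %/ 2 ^ t) 2) -!divnMA.
  by rewrite -!expnSr e !modn2 eo.
rewrite ltn_subLR; last exact: ltnW.
rewrite {1}(divn_eq m (2 ^ t.+1)) e.
rewrite {2}(divn_eq l (2 ^ t.+1)) -addnA ltn_add2l.
by rewrite (leq_trans (ltn_pmod _ _)) ?expn_gt0 // leq_addl.
Qed.

(** * Riesz products of lacunary Walsh characters *)

(** Only [n - M < j < k <= n] is possible. *)
Lemma card_window (n M k : nat) : (k <= n)%N ->
  (#|(fun j : 'I_k => (n < j + M)%N)| <= M)%N.
Proof.
move=> kn; rewrite -sum1_card big_mkcond /=.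
under eq_bigr do rewrite unfold_in.
apply: (@leq_trans (k + M - n)%N); last by lia.
elim: k kn => [|k IHk] kn; first by rewrite big_ord0.
rewrite big_ord_recr /=; have := IHk (ltnW kn).
by case: ifP; lia.
Qed.

Section Riesz.
Context {R : realType}.
Variables (N : nat) (mu : nat -> nat) (tau : R).
Hypotheses (tau_ge0 : 0 <= tau) (tau_le1 : tau <= 1).
Implicit Types (b : nat -> bool) (k : nat).
Notation chi := (@walsh_char R N).

Definition riesz k (x : R) : R := \prod_(j < k) (1 + tau * chi (bit (mu j)) x).

Definition riesz_coef k b : R := mean (fun x => riesz k x * chi b x).

Definition riesz_mass k : R := mean (riesz k).

Lemma bounded_measurable_riesz k : bounded_measurable (riesz k).
Proof.
apply: bounded_measurable_prod => j.
apply: bounded_measurableD; first exact: bounded_measurable_cst.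
apply: bounded_measurableM; first exact: bounded_measurable_cst.
exact: bounded_measurable_char.
Qed.

Let bm_coef k b : bounded_measurable (fun x => riesz k x * chi b x).
Proof.
apply: bounded_measurableM; first exact: bounded_measurable_riesz.
exact: bounded_measurable_char.
Qed.

Lemma riesz_ge0 k x : 0 <= riesz k x.
Proof.
apply: prodr_ge0 => j _.
by have [->|->] := walsh_char_pm1 N (bit (mu j)) x;
  rewrite ?mulrN1 ?mulr1 ?subr_ge0 ?addr_ge0.
Qed.

Lemma riesz_coef0 b : riesz_coef 0 b = mean (chi b).
Proof. by congr mean; apply/funext => x; rewrite /riesz big_ord0 mul1r. Qed.

Lemma riesz_coefS k b : riesz_coef k.+1 b =
  riesz_coef k b + tau * riesz_coef k (fun i => bit (mu k) i (+) b i).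
Proof.
rewrite /riesz_coef -meanZ // -meanD //; last first.
  by apply: bounded_measurableM => //; exact: bounded_measurable_cst.
congr mean; apply/funext => x; rewrite -walsh_charM /riesz big_ord_recr /=.
by ring.
Qed.

Lemma riesz_mass0 : riesz_mass 0 = 1.
Proof.
rewrite -[RHS](mean_cst (R := R)); congr mean; apply/funext => x.
by rewrite /riesz big_ord0.
Qed.

Lemma riesz_massS k :
  riesz_mass k.+1 = riesz_mass k + tau * riesz_coef k (bit (mu k)).
Proof.
rewrite /riesz_mass /riesz_coef -meanZ // -meanD //; last 2 first.
- exact: bounded_measurable_riesz.
- by apply: bounded_measurableM => //; exact: bounded_measurable_cst.
by congr mean; apply/funext => x; rewrite /riesz big_ord_recr /=; ring.
Qed.

Lemma riesz_coef_ge0 k b : 0 <= riesz_coef k b.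
Proof.
elim: k b => [|k IHk] b; first by rewrite riesz_coef0 mean_char_ge0.
by rewrite riesz_coefS addr_ge0 // mulr_ge0.
Qed.

(** Being the Fourier coefficients of a nonnegative function, they are dominated
    by the coefficient of the constant character. *)
Lemma riesz_coef_le_mass k b : riesz_coef k b <= riesz_mass k.
Proof.
apply: mean_le => // [|x]; first exact: bounded_measurable_riesz.
rewrite -[leRHS]mulr1 ler_wpM2l ?riesz_ge0 //.
by rewrite (le_trans (ler_norm _)) // walsh_char_norm.
Qed.

Lemma riesz_mass_mono j k : (j <= k)%N -> riesz_mass j <= riesz_mass k.
Proof.
move=> /subnK <-; elim: (k - j)%N => // i /le_trans; apply.
by rewrite addSn riesz_massS lerDl mulr_ge0 // riesz_coef_ge0.
Qed.

(** In the expansion over sets of characters, the terms are grouped by the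
    largest index of the set, and [mean (chi b)] is the empty set. *)
Lemma riesz_coef_sum k b : riesz_coef k b = mean (chi b) +
  tau * \sum_(j < k) riesz_coef j (fun i => bit (mu j) i (+) b i).
Proof.
elim: k => [|k IHk]; first by rewrite riesz_coef0 big_ord0 mulr0 addr0.
by rewrite riesz_coefS IHk big_ord_recr /= mulrDr addrA.
Qed.

(** The digit [t] survives in [b] whatever smaller characters are added to it, so
    no set of them has product [chi b]. *)
Lemma riesz_coef_vanish k b t : (t < N)%N -> b t ->
  (forall j, (j < k)%N -> (mu j < 2 ^ t)%N) -> riesz_coef k b = 0.
Proof.
move=> tN; elim: k b => [|k IHk] b bt small.
  by rewrite riesz_coef0 (@mean_char0 _ _ _ t).
have smallk j : (j < k)%N -> (mu j < 2 ^ t)%N.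
  by move=> jk; apply: small; rewrite ltnS ltnW.
rewrite riesz_coefS !IHk ?mulr0 ?addr0 //.
by rewrite bit_small ?small.
Qed.

Hypothesis mu_lt : forall i j, (i < j)%N -> (mu i < mu j)%N.

(** Only an index [j] with [2 ^ t <= mu j] can be the largest one of a set of
    characters that cancels the digit [t] of [b], and at most [M] indices below
    [n] qualify. *)
Lemma riesz_coef_window n M k b t (c : R) : (t < N)%N -> b t -> (k <= n)%N ->
  (forall j, (j < k)%N -> (j + M <= n)%N -> (mu j < 2 ^ t)%N) -> 0 <= c ->
  (forall j, (j < k)%N -> riesz_coef j (fun i => bit (mu j) i (+) b i) <= c) ->
  riesz_coef k b <= tau * (M%:R * c).
Proof.
move=> tN bt kn small c0 cb.
rewrite riesz_coef_sum (@mean_char0 _ _ _ t) // add0r ler_wpM2l //.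
apply: (@le_trans _ _ (\sum_(j < k) if (n < j + M)%N then c else 0)).
  apply: ler_sum => j _; have [jM|_] := leqP (j + M) n; last exact: cb.
  rewrite (@riesz_coef_vanish _ _ t) //.
    by rewrite bit_small ?small.
  move=> i ij; apply: leq_ltn_trans (small _ (ltn_ord j) jM).
  exact/ltnW/mu_lt.
rewrite -big_mkcond /= sumr_const -[_ *+ _]mulr_natl ler_wpM2r // ler_nat.
exact: card_window.
Qed.

(** In a relation between characters with largest index [k], there are at most [M]
    choices for the second index, and then at most [M] for the third; each of the
    three indices contributes a factor [tau]. *)
Lemma riesz_mass_step k M : (mu k <= N)%N -> (0 < mu k)%N ->
  (forall l j, (l < k)%N -> (j + M <= k)%N -> (2 * mu j <= mu k - mu l)%N) ->
  riesz_mass k.+1 <= riesz_mass k * (1 + M%:R ^+ 2 * tau ^+ 3).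
Proof.
move=> muN mu0 lac.
have E0 : 0 <= riesz_mass k.
  by apply: le_trans (riesz_coef_ge0 k (fun=> false)) (riesz_coef_le_mass _ _).
have M0 : (0 : R) <= M%:R by rewrite ler0n.
have c1 : 0 <= M%:R * riesz_mass k by rewrite mulr_ge0.
suff : riesz_coef k (bit (mu k)) <=
    tau * (M%:R * (tau * (M%:R * riesz_mass k))).
  move=> /(ler_wpM2l tau_ge0) h; rewrite riesz_massS.
  rewrite (le_trans (lerD (lexx _) h)) // le_eqVlt; apply/orP; left.
  by apply/eqP; ring.
(* The second index must cancel the leading digit of [mu k]. *)
have [t bt mut] := top_bit mu0.
have tN : (t < N)%N := bit_lt_size bt muN.
apply: (@riesz_coef_window k M k _ t) => //.
- move=> j jk jM; rewrite -(@ltn_pmul2l 2) // -expnS.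
  by apply: leq_ltn_trans (lac _ _ jk jM) (leq_ltn_trans (leq_subr _ _) mut).
- by rewrite mulr_ge0.
(* The residual of [mu k] and [mu l] has a digit of the order of [mu k - mu l],
   which the third index must cancel. *)
move=> l lk; have [s bs mus] := top_differing_bit (mu_lt lk).
have sN : (s < N)%N.
  have [/bit_lt_size/(_ muN) //|nb] := boolP (bit (mu k) s).
  move: bs; rewrite (negbTE nb) /= => /bit_lt_size; apply.
  by apply: leq_trans muN; exact/ltnW/mu_lt.
apply: (@riesz_coef_window k M l _ s) => //.
- by rewrite addbC.
- exact: ltnW.
- move=> j jl jM; rewrite -(@ltn_pmul2l 2) // -expnS.
  exact: leq_ltn_trans (lac _ _ lk jM) mus.
- move=> j jl; apply: le_trans (riesz_coef_le_mass _ _) _.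
  by apply: riesz_mass_mono; exact/ltnW/(ltn_trans jl).
Qed.

Lemma riesz_mass_bound n M : (forall k, (k < n)%N -> (mu k <= N)%N) ->
  (forall k, (0 < mu k)%N) ->
  (forall k l j, (l < k)%N -> (j + M <= k)%N -> (2 * mu j <= mu k - mu l)%N) ->
  riesz_mass n <= (1 + M%:R ^+ 2 * tau ^+ 3) ^+ n.
Proof.
move=> muN mu0 lac.
have B0 : 0 <= 1 + M%:R ^+ 2 * tau ^+ 3.
  by rewrite addr_ge0 // mulr_ge0 ?exprn_ge0.
elim: n muN => [|n IHn] muN; first by rewrite riesz_mass0 expr0.
rewrite exprSr (le_trans (riesz_mass_step _ _ (lac n))) ?muN //.
by rewrite ler_wpM2r // IHn // => k kn; rewrite muN // ltnW.
Qed.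

(** With dyadic gaps the characters are independent: each new one carries a
    Rademacher factor that occurs in none of the previous ones. *)
Lemma riesz_mass_dyadic n : (forall k, (k < n)%N -> (mu k <= N)%N) ->
  (forall k, (0 < mu k)%N) ->
  (forall k j, (j < k)%N -> (2 * mu j <= mu k)%N) ->
  riesz_mass n = 1.
Proof.
move=> muN mu0 gap; elim: n muN => [|n IHn] muN; first exact: riesz_mass0.
rewrite riesz_massS IHn; last by move=> k kn; rewrite muN // ltnW.
have [t bt mut] := top_bit (mu0 n).
rewrite (@riesz_coef_vanish _ _ t) ?mulr0 ?addr0 //.
  by apply: bit_lt_size bt _; exact: muN.
move=> j jn; rewrite -(@ltn_pmul2l 2) // -expnS.
exact: leq_ltn_trans (gap _ _ jn) mut.
Qed.

End Riesz.

(** * Moment generating functions of Walsh sums *)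

Section MomentGeneratingFunction.
Context {R : realType}.
Notation T := (measurableTypeR R).
Notation P := (@unit_interval_prob R).
Variables (N n : nat) (mu : nat -> nat).
Notation chi k := (@walsh_char R N (bit (mu k))).

Lemma Re_sum (I : finType) (F : I -> R[i]) :
  complex.Re (\sum_i F i) = \sum_i complex.Re (F i).
Proof. exact: raddf_sum. Qed.

Lemma Im_sum (I : finType) (F : I -> R[i]) :
  complex.Im (\sum_i F i) = \sum_i complex.Im (F i).
Proof. exact: raddf_sum. Qed.

Lemma ReM_real (c : R[i]) (r : R) : complex.Re (c * r%:C) = complex.Re c * r.
Proof. by case: c => a b /=; rewrite mulr0 subr0. Qed.

Lemma ImM_real (c : R[i]) (r : R) : complex.Im (c * r%:C) = complex.Im c * r.
Proof. by case: c => a b /=; rewrite mulr0 add0r. Qed.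

Section Expectation.
Variables (I : finType) (c : I -> R[i]) (V : I -> T -> R).
Hypothesis bV : forall i, bounded_measurable (V i).
Let F x := \sum_i c i * (V i x)%:C.

Let bmZ (r : R) i : bounded_measurable (fun x => r * V i x).
Proof. by apply: bounded_measurableM => //; exact: bounded_measurable_cst. Qed.

Let ReF : (fun x => complex.Re (F x)) =
  (fun x => \sum_i complex.Re (c i) * V i x).
Proof.
by apply/funext => x; rewrite /F Re_sum; apply: eq_bigr => i _; rewrite ReM_real.
Qed.

Let ImF : (fun x => complex.Im (F x)) =
  (fun x => \sum_i complex.Im (c i) * V i x).
Proof.
by apply/funext => x; rewrite /F Im_sum; apply: eq_bigr => i _; rewrite ImM_real.
Qed.

Lemma cexpectation_sum :
  cexpectation P F = \sum_i c i * (mean (V i))%:C.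
Proof.
rewrite /cexpectation ReF ImF -!/(mean _) !mean_sum //.
apply/eqP; rewrite eq_complex Re_sum Im_sum /=; apply/andP.
by split; apply/eqP/eq_bigr => i _; rewrite ?ReM_real ?ImM_real meanZ.
Qed.

Lemma cintegrable_sum : cintegrable P F.
Proof.
split.
- apply: (@bounded_measurable_integrable _ (fun x => complex.Re (F x))).
  by rewrite ReF; exact: bounded_measurable_sum.
- apply: (@bounded_measurable_integrable _ (fun x => complex.Im (F x))).
  by rewrite ImF; exact: bounded_measurable_sum.
Qed.

End Expectation.

Definition char_prod (A : {set 'I_n}) (x : R) : R := \prod_(k in A) chi k x.

Lemma char_prodE A : exists b, char_prod A = walsh_char N b.
Proof.
suff [b e] : exists b, forall x, char_prod A x = walsh_char N b x.
  by exists b; apply/funext.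
rewrite /char_prod; elim: (index_enum _) => [|k r [b IHr]].
  by exists (fun=> false) => x; rewrite big_nil walsh_char0.
have [kA|kA] := boolP (k \in A).
  exists (fun i => bit (mu k) i (+) b i) => x.
  by rewrite big_cons kA IHr walsh_charM.
by exists b => x; rewrite big_cons (negbTE kA) IHr.
Qed.

Lemma bounded_measurable_char_prod A : bounded_measurable (char_prod A).
Proof. by have [b ->] := char_prodE A; exact: bounded_measurable_char. Qed.

Lemma mean_char_prod_ge0 A : 0 <= mean (char_prod A).
Proof. by have [b ->] := char_prodE A; exact: mean_char_ge0. Qed.

Lemma mean_char_prod0 : mean (char_prod finset.set0) = 1.
Proof.
rewrite -[RHS](mean_cst (R := R)); congr mean; apply/funext => x.
by rewrite /char_prod finset.big_set0.
Qed.

Lemma riesz_mass_subsets tau :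
  riesz_mass N mu tau n =
    \sum_(A : {set 'I_n}) tau ^+ #|A| * mean (char_prod A).
Proof.
transitivity (mean (fun x => \sum_(A : {set 'I_n}) tau ^+ #|A| * char_prod A x)).
  congr mean; apply/funext => x; rewrite /riesz.
  under eq_bigr do rewrite addrC.
  rewrite bigA_distr; apply: eq_bigr => A _.
  rewrite -big_mkcond /= big_split /= prodr_const; congr (_ * _).
have bm A := bounded_measurable_char_prod A.
rewrite mean_sum; last first.
  by move=> A; apply: bounded_measurableM => //; exact: bounded_measurable_cst.
by apply: eq_bigr => A _; rewrite meanZ.
Qed.

Lemma cexp_pm1 (z : R[i]) (e : R) : e = 1 \/ e = -1 ->
  cexp (z * e%:C) = csinh z * e%:C + ccosh z.
Proof.
by move=> [->|->]; rewrite /csinh /ccosh ?rmorphN rmorph1 ?mulrN mulr1; field.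
Qed.

Variables (a : 'I_n -> R) (z : R[i]).

Definition char_sum (x : T) : R := \sum_k a k * chi k x.

Let coef (A : {set 'I_n}) : R[i] :=
  \prod_k (if k \in A then csinh ((a k)%:C * z) else ccosh ((a k)%:C * z)).

Lemma cexp_char_sum x : cexp (z * (char_sum x)%:C) =
  \sum_(A : {set 'I_n}) coef A * (char_prod A x)%:C.
Proof.
rewrite /char_sum rmorph_sum mulr_sumr cexp_sum.
transitivity (\prod_k (csinh ((a k)%:C * z) * (chi k x)%:C +
                       ccosh ((a k)%:C * z))).
  apply: eq_bigr => k _; rewrite rmorphM /= mulrA (mulrC z) cexp_pm1 //.
  exact: walsh_char_pm1.
rewrite bigA_distr; apply: eq_bigr => A _.
rewrite /char_prod rmorph_prod /= [X in _ * X]big_mkcond /= /coef -big_split /=.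
by apply: eq_bigr => k _; case: ifP; rewrite ?mulr1.
Qed.

Lemma cmgf_char_sum_exists : cmgf_exists P char_sum z.
Proof.
rewrite /cmgf_exists (_ : (fun w => _) = fun x =>
    \sum_(A : {set 'I_n}) coef A * (char_prod A x)%:C); last first.
  by apply/funext => x; exact: cexp_char_sum.
by apply: cintegrable_sum => A; exact: bounded_measurable_char_prod.
Qed.

(** Expanding over sets of characters, every expectation that occurs is
    nonnegative, so the non-constant terms are dominated by those of the Riesz
    product with the constant coefficient [tau]. *)
Lemma cmgf_char_sum_le (tau : R) :
  (forall k, ccosh ((a k)%:C * z) != 0) ->
  (forall k, cmod (csinh ((a k)%:C * z) / ccosh ((a k)%:C * z)) <= tau) ->
  cmod (cmgf P char_sum z - \prod_k ccosh ((a k)%:C * z)) <=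
    cmod (\prod_k ccosh ((a k)%:C * z)) * (riesz_mass N mu tau n - 1).
Proof.
move=> ch0 tle; set C := \prod_k _.
have coefE A : coef A = C *
    \prod_(k in A) (csinh ((a k)%:C * z) / ccosh ((a k)%:C * z)).
  rewrite /C /coef [X in _ * X]big_mkcond -big_split; apply: eq_bigr => k _ /=.
  by case: ifP => _; rewrite ?mulr1 // mulrCA divff ?mulr1.
have -> : cmgf P char_sum z =
    \sum_(A : {set 'I_n}) coef A * (mean (char_prod A))%:C.
  rewrite /cmgf (_ : (fun w => _) = fun x =>
    \sum_(A : {set 'I_n}) coef A * (char_prod A x)%:C); last first.
    by apply/funext => x; exact: cexp_char_sum.
  by apply: cexpectation_sum => A; exact: bounded_measurable_char_prod.
rewrite (bigD1 finset.set0) //= mean_char_prod0 coefE finset.big_set0.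
rewrite rmorph1 !mulr1 [_ - C]addrC addKr.
have -> : riesz_mass N mu tau n - 1 =
    \sum_(A : {set 'I_n} | A != finset.set0) tau ^+ #|A| * mean (char_prod A).
  rewrite riesz_mass_subsets (bigD1 finset.set0) //= cards0 mean_char_prod0.
  by rewrite mulr1 expr0 [_ - 1]addrC addKr.
rewrite mulr_sumr.
apply: le_trans (cmod_sum _ _ _) _; apply: ler_sum => A _.
rewrite coefE !cmodM cmodR ger0_norm ?mean_char_prod_ge0 // -mulrA.
rewrite ler_wpM2l ?cmod_ge0 // ler_wpM2r ?mean_char_prod_ge0 //.
rewrite -prodr_const; apply: (big_ind2 (fun u v => cmod u <= v)).
- by rewrite cmod1.
- by move=> *; rewrite cmodM; apply: ler_pM; rewrite ?cmod_ge0.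
- by move=> k _; exact: tle.
Qed.

End MomentGeneratingFunction.

(** * Lacunary sequences *)

Section Lacunary.
Context {R : realType}.
Variables (q : R) (mu : nat -> nat).
Hypotheses (q_gt1 : 1 < q) (mu_gt0 : forall k, (0 < mu k)%N).
Hypothesis mu_ratio : forall k, q <= (mu k.+1)%:R / (mu k)%:R.

Lemma lacunary_step k : q * (mu k)%:R <= (mu k.+1)%:R.
Proof. by rewrite -ler_pdivlMr ?ltr0n. Qed.

Lemma lacunary_growth i j : q ^+ i * (mu j)%:R <= (mu (j + i))%:R.
Proof.
elim: i => [|i IHi]; first by rewrite mul1r addn0.
rewrite exprS -mulrA addnS (le_trans _ (lacunary_step _)) //.
by rewrite ler_wpM2l //; have := q_gt1; lra.
Qed.

Lemma lacunary_gt i j : (i < j)%N -> (mu i < mu j)%N.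
Proof.
elim: j => // j IHj; have jj : (mu j < mu j.+1)%N.
  rewrite -(ltr_nat R); apply: lt_le_trans (lacunary_step j).
  by rewrite ltr_pMl // ltr0n.
by rewrite ltnS leq_eqVlt => /predU1P[->//|/IHj/ltn_trans]; apply.
Qed.

Lemma lacunary_doubling j k : 2 <= q -> (j < k)%N -> (2 * mu j <= mu k)%N.
Proof.
move=> q2 jk; rewrite -(ler_nat R) natrM.
have h : q * (mu j)%:R <= (mu k)%:R.
  apply: le_trans (lacunary_step j) _; rewrite ler_nat.
  by move: jk; rewrite leq_eqVlt => /predU1P[->//|/lacunary_gt/ltnW].
by apply: le_trans h; rewrite ler_wpM2r.
Qed.

Lemma power_unbounded (c : R) : exists M, c <= q ^+ M.
Proof.
have q0 : 0 < q - 1 by rewrite subr_gt0.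
exists (Num.truncn (`|c| / (q - 1))).+1; set M := _.+1.
have h : `|c| <= M%:R * (q - 1).
  rewrite -ler_pdivrMr // /M.
  exact/ltW/truncnS_gt.
(* Bernoulli's inequality for [q = 1 + (q - 1)]. *)
have bern n : 1 + n%:R * (q - 1) <= q ^+ n.
  elim: n => [|n IHn]; first by rewrite mul0r addr0.
  rewrite exprS; apply: le_trans (ler_wpM2l _ IHn); last by have := q0; lra.
  have n0 : 0 <= n%:R * (q - 1) ^+ 2 by rewrite mulr_ge0 ?sqr_ge0.
  by rewrite -natr1; lra.
have := bern M; have := ler_norm c; lra.
Qed.

(** A difference of two terms is a fixed proportion of the larger one, and the
    sequence outgrows any fixed proportion within a bounded number of steps. *)
Lemma lacunary_gap : exists M, forall k l j, (l < k)%N -> (j + M <= k)%N ->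
  (2 * mu j <= mu k - mu l)%N.
Proof.
(* [mu k - mu l >= (1 - 1/q) mu k], and [2 / (1 - 1/q) = 2q / (q - 1)]. *)
have [M qM] := power_unbounded (2 * q / (q - 1)); exists M => k l j lk jMk.
rewrite -(ler_nat R) natrM natrB; last exact/ltnW/lacunary_gt.
have h1 : q * (mu l)%:R <= (mu k)%:R.
  apply: le_trans (lacunary_step l) _; rewrite ler_nat.
  by move: lk; rewrite leq_eqVlt => /predU1P[->//|/lacunary_gt/ltnW].
have h2 : q ^+ M * (mu j)%:R <= (mu k)%:R.
  apply: le_trans (lacunary_growth M j) _; rewrite ler_nat.
  by move: jMk; rewrite leq_eqVlt => /predU1P[->//|/lacunary_gt/ltnW].
have h3 : 2 * q / (q - 1) * (mu j)%:R <= (mu k)%:R.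
  by apply: le_trans h2; rewrite ler_wpM2r.
have q1 : 0 < q - 1 by rewrite subr_gt0.
rewrite mulrAC ler_pdivrMr // in h3.
rewrite -(ler_pM2l (_ : 0 < q)); last by have := q1; lra.
nra.
Qed.

End Lacunary.

(** * The estimate for a fixed number of terms *)

Section FixedLength.
Context {R : realType}.

(** The two summands on the right are the error of the Riesz product and the error
    of the factorwise comparison; the exponential bounds the products
    of factors that occur in both. The condition on [d * Z] keeps [cosh (a_k z)] away
    from 0, so that the hyperbolic tangents are at most [2 e d Z]. *)
Lemma cmgf_gauss_le : exists2 K : R, 0 <= K &
  forall (N n : nat) (mu : nat -> nat) (a : 'I_n -> R) (d Z : R) (z : R[i]),
  0 <= d -> (forall k, `|a k| <= d) -> cmod z <= Z -> expR 1 * (d * Z) <= 2^-1 ->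
  cmod (cmgf (@unit_interval_prob R) (@char_sum R N n mu a) z *
        cexp (- ((\sum_k a k ^+ 2)%:C * z ^+ 2 / 2)) -
        cexp (- (z ^+ 4 / 12 * (\sum_k a k ^+ 4)%:C)))
  <= expR ((1 + K) * (Z ^+ 4 * \sum_k a k ^+ 4)) *
     (riesz_mass N mu (2 * expR 1 * (d * Z)) n - 1 +
      n%:R * (K * (d * Z) ^+ 6)).
Proof.
have [K K0 Kle] := @ccosh_gauss_quartic R; exists K => //.
move=> N n mu a d Z z d0 ad zZ edZ.
set s4 := \sum_k a k ^+ 4; set tau := 2 * expR 1 * (d * Z).
have Z0 : 0 <= Z by exact: le_trans (cmod_ge0 z) zZ.
have e1 : 1 <= expR 1 :> R by rewrite -expR0 ler_expR.
have dZ0 : 0 <= d * Z by rewrite mulr_ge0.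
have dZ1 : d * Z <= 1 by nra.
pose w k := (a k)%:C * z.
have cw k : cmod (w k) = `|a k| * cmod z by rewrite cmodM cmodR.
have wd k : cmod (w k) <= d * Z by rewrite cw ler_pM ?cmod_ge0.
have w1 k : cmod (w k) <= 1 by exact: le_trans (wd k) dZ1.
have w4 k : cmod (w k) ^+ 4 <= Z ^+ 4 * a k ^+ 4.
  rewrite cw exprMn mulrC -normrX ger0_norm ?exprn_even_ge0 //.
  by rewrite ler_wpM2r ?exprn_even_ge0 // lerXn2r ?nnegrE ?cmod_ge0.
have ew k : expR 1 * cmod (w k) <= 2^-1.
  by apply: le_trans edZ; rewrite ler_wpM2l ?expR_ge0.
pose u k := ccosh (w k) * cexp (- (w k ^+ 2 / 2)).
pose v k := cexp (- (w k ^+ 4 / 12)).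
pose B k := expR ((1 + K) * (Z ^+ 4 * a k ^+ 4)).
have uv k : cmod (u k - v k) <= K * cmod (w k) ^+ 6 by apply: Kle.
have B1 k : 1 <= B k.
  rewrite -expR0 ler_expR mulr_ge0 ?addr_ge0 // mulr_ge0 //.
    exact: exprn_ge0.
  exact: exprn_even_ge0.
have cv4 k : cmod (- (w k ^+ 4 / 12)) = cmod (w k) ^+ 4 / 12.
  by rewrite cmodN cmodM cmodX cmodV cmod_nat.
have vb k : cmod (v k) <= expR (cmod (w k) ^+ 4).
  apply: le_trans (cmod_cexp_le _) _; rewrite ler_expR cv4.
  by rewrite ler_pdivrMr // ler_peMr ?exprn_ge0 ?cmod_ge0 // ler1n.
have w40 k : 0 <= cmod (w k) ^+ 4 by rewrite exprn_ge0 ?cmod_ge0.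
have Bw k : expR (cmod (w k) ^+ 4) * expR (K * cmod (w k) ^+ 4) <= B k.
  rewrite -expRD ler_expR -{1}[_ ^+ 4]mul1r -mulrDl ler_wpM2l ?w4 //; lra.
have vB k : cmod (v k) <= B k.
  apply: le_trans (vb k) (le_trans _ (Bw k)).
  by rewrite ler_peMr ?expR_ge0 // -expR0 ler_expR mulr_ge0.
have uB k : cmod (u k) <= B k.
  have -> : u k = v k + (u k - v k) by rewrite addrC subrK.
  apply: le_trans (cmodD _ _) (le_trans _ (Bw k)).
  have E1 := expR_ge1Dx (K * cmod (w k) ^+ 4).
  have E0 : 1 <= expR (cmod (w k) ^+ 4) by rewrite -expR0 ler_expR.
  have h6 : cmod (w k) ^+ 6 <= cmod (w k) ^+ 4.
    by rewrite (exprD _ 4 2) ler_piMr // exprn_ile1 ?cmod_ge0.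
  have h7 : K * cmod (w k) ^+ 6 <= K * cmod (w k) ^+ 4 by rewrite ler_wpM2l.
  have h8 : 0 <= K * cmod (w k) ^+ 4 by rewrite mulr_ge0.
  have := uv k; have := vb k; nra.
have prodB : \prod_k B k = expR ((1 + K) * (Z ^+ 4 * s4)).
  by rewrite /B -expR_sum -mulr_sumr -mulr_sumr.
have produ : \prod_k u k = \prod_k ccosh (w k) *
    cexp (- ((\sum_k a k ^+ 2)%:C * z ^+ 2 / 2)).
  rewrite /u big_split /= -cexp_sum; congr (_ * cexp _).
  rewrite sumrN -mulr_suml; congr (- (_ / _)).
  rewrite rmorph_sum mulr_suml; apply: eq_bigr => k _.
  by rewrite /w exprMn rmorphXn.
have prodv : \prod_k v k = cexp (- (z ^+ 4 / 12 * s4%:C)).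
  rewrite /v -cexp_sum; congr cexp.
  rewrite sumrN rmorph_sum mulr_sumr; congr (- _); apply: eq_bigr => k _.
  by rewrite /w exprMn rmorphXn /= mulrC mulrA mulrAC (mulrC 12^-1).
rewrite -prodv -prodB.
set G := cexp _ in produ *; set F := cmgf _ _ _.
have -> : F * G - \prod_k v k =
  (F - \prod_k ccosh (w k)) * G + (\prod_k u k - \prod_k v k).
  by rewrite produ; ring.
apply: le_trans (cmodD _ _) _; rewrite mulrDr; apply: lerD.
  have := @cmgf_char_sum_le R N n mu a z tau _ _.
  rewrite -/w => /(_ _ _) h.
  rewrite cmodM; apply: le_trans (ler_wpM2r (cmod_ge0 _) (h _ _)) _.
  - move=> k; rewrite -cmod_eq0 gt_eqF //.
    by apply: lt_le_trans (cmod_ccosh_ge (ew k) (w1 k)); rewrite invr_gt0.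
  - move=> k; apply: le_trans (ctanh_le (ew k) (w1 k)) _.
    by rewrite /tau ler_wpM2l ?mulr_ge0 ?expR_ge0.
  rewrite mulrAC -cmodM -produ ler_wpM2r //.
    rewrite subr_ge0 -(riesz_mass0 N mu tau).
    by apply: riesz_mass_mono => //; rewrite /tau !mulr_ge0 ?expR_ge0.
  apply: (big_ind2 (fun x y => cmod x <= y)) => //; first by rewrite cmod1.
  by move=> *; rewrite cmodM; apply: ler_pM; rewrite ?cmod_ge0.
apply: le_trans (cmod_prod_sub B1 uB vB) _.
rewrite mulrC ler_wpM2l //.
  by apply: prodr_ge0 => k _; exact: expR_ge0.
apply: (@le_trans _ _ (\sum_(k < n) K * (d * Z) ^+ 6)).
  apply: ler_sum => k _; apply: le_trans (uv k) _; rewrite ler_wpM2l //.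
  by rewrite lerXn2r ?nnegrE ?cmod_ge0.
by rewrite sumr_const card_ord mulr_natl.
Qed.

End FixedLength.

(** * Triangular arrays *)

Section Arrays.
Context {R : realType}.
Variable a : nat -> nat -> R.
Notation d := (array_max a).

Lemma array_max_ge0 n : 0 <= d n.
Proof.
rewrite /array_max; elim/big_ind: _ => // x y x0 y0.
by rewrite le_max x0.
Qed.

Lemma array_max_ge n (k : 'I_n) : `|a k.+1 n| <= d n.
Proof.
rewrite /array_max big_add1 /= big_mkord.
exact: (le_bigmax _ (fun k : 'I_n => `|a k.+1 n|)).
Qed.

Lemma sum_array n (F : nat -> R) :
  \sum_(1 <= k < n.+1) F k = \sum_(k < n) F k.+1.
Proof. by rewrite big_add1 /= big_mkord. Qed.

Lemma array_norm_sqr n : array_norm a n ^+ 2 = \sum_(k < n) a k.+1 n ^+ 2.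
Proof.
rewrite /array_norm sqr_sqrtr ?sum_array //.
by apply: sumr_ge0 => k _; exact: sqr_ge0.
Qed.

Lemma walsh_sum_char N n m : (forall k, (k < n)%N -> (m k.+1 <= N)%N) ->
  walsh_sum m a n =
  char_sum N (fun k => m k.+1) (fun k : 'I_n => a k.+1 n).
Proof.
move=> mN; apply/funext => x; rewrite /walsh_sum /char_sum.
rewrite big_add1 /= big_mkord; apply: eq_bigr => k _.
by rewrite (@walshE _ N) ?mN.
Qed.

Lemma array_max_cvg0 p :
  (fun n => n%:R * d n ^+ p.+1) @ \oo --> (0 : R) -> d @ \oo --> (0 : R).
Proof.
move=> /cvgr0Pnorm_le h; apply/cvgr0Pnorm_le => e e0.
have {}h := h _ (exprn_gt0 p.+1 e0).
near=> n.
have n1 : (0 < n)%N by near: n; exact: nbhs_infty_gt.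
have : `|n%:R * d n ^+ p.+1| <= e ^+ p.+1 by near: n.
have d0 := array_max_ge0 n.
rewrite ger0_norm ?mulr_ge0 ?exprn_ge0 // (ger0_norm d0) => le1.
rewrite -(@ler_pXn2r _ p.+1) ?nnegrE ?(ltW e0) // (le_trans _ le1) //.
by rewrite ler_peMl ?exprn_ge0 // ler1n.
Unshelve. all: by end_near. Qed.

Lemma array_max_cvgS p : (fun n => n%:R * d n ^+ p.+1) @ \oo --> (0 : R) ->
  (fun n => n%:R * d n ^+ p.+2) @ \oo --> (0 : R).
Proof.
move=> h; rewrite (_ : (fun n => _) = fun n => n%:R * d n ^+ p.+1 * d n).
  by rewrite -[X in _ --> X](mulr0 (0 : R)); exact: cvgM h (array_max_cvg0 h).
by apply/funext => n; rewrite exprSr mulrA.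
Qed.

Lemma sum_quartic_cvg0 : (fun n => n%:R * d n ^+ 4) @ \oo --> (0 : R) ->
  (fun n => \sum_(1 <= k < n.+1) a k n ^+ 4) @ \oo --> (0 : R).
Proof.
apply: (@squeeze_cvgr _ _ _ _ (fun=> 0)); last exact: cvg_cst.
near=> n; rewrite sum_array; apply/andP; split.
  by apply: sumr_ge0 => k _; exact: exprn_even_ge0.
apply: (@le_trans _ _ (\sum_(k < n) d n ^+ 4)).
  apply: ler_sum => k _; rewrite -[a _ _ ^+ 4]ger0_norm ?exprn_even_ge0 //.
  by rewrite normrX lerXn2r ?nnegrE ?array_max_ge0 ?array_max_ge.
by rewrite sumr_const card_ord mulr_natl.
Unshelve. all: by end_near. Qed.

Lemma power_rate_cvg (eps : R) p : 0 < eps ->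
  (fun n : nat => n%:R `^ (1 + eps) * d n ^+ p) @ \oo --> (0 : R) ->
  (fun n : nat => n%:R * d n ^+ p) @ \oo --> (0 : R).
Proof.
move=> e0; apply: (@squeeze_cvgr _ _ _ _ (fun=> 0)); last exact: cvg_cst.
near=> n; have n1 : (0 < n)%N by near: n; exact: nbhs_infty_gt.
have dp : 0 <= d n ^+ p by rewrite exprn_ge0 ?array_max_ge0.
by rewrite mulr_ge0 //= ler_wpM2r // le1r_powR ?ler1n // lerDl ltW.
Unshelve. all: by end_near. Qed.

End Arrays.

(** * Convergence of the Riesz masses *)

Section MassLimit.
Context {R : realType}.
Variables (mu : nat -> nat) (N : nat -> nat).
Hypothesis mu_gt0 : forall k, (0 < mu k)%N.
Hypothesis mu_lt : forall i j, (i < j)%N -> (mu i < mu j)%N.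
Hypothesis muN : forall n k, (k < n)%N -> (mu k <= N n)%N.

Lemma riesz_mass_cvg1 M (tau : nat -> R) :
  (forall k l j, (l < k)%N -> (j + M <= k)%N -> (2 * mu j <= mu k - mu l)%N) ->
  (forall n, 0 <= tau n) -> tau @ \oo --> (0 : R) ->
  (fun n => n%:R * tau n ^+ 3) @ \oo --> (0 : R) ->
  (fun n => riesz_mass (N n) mu (tau n) n) @ \oo --> (1 : R).
Proof.
move=> lac tau0 cvt cvt3.
have : (fun n => expR (M%:R ^+ 2 * (n%:R * tau n ^+ 3))) @ \oo -->
    expR (M%:R ^+ 2 * 0).
  apply: continuous_cvg; first exact: continuous_expR.
  by apply: cvgM cvt3; exact: cvg_cst.
rewrite mulr0 expR0.
apply: (@squeeze_cvgr _ _ _ _ (fun=> 1)); last exact: cvg_cst.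
near=> n; have t0 := tau0 n.
have t1 : tau n <= 1.
  near: n; have /cvgr0Pnorm_le/(_ _ ltr01) := cvt; apply: filterS => i.
  by rewrite ger0_norm.
rewrite -{1}(riesz_mass0 (N n) mu (tau n)) riesz_mass_mono //=.
apply: le_trans (riesz_mass_bound _ _ mu_lt _ _ lac) _ => //; first exact: muN.
apply: (@le_trans _ _ (expR (M%:R ^+ 2 * tau n ^+ 3) ^+ n)).
  by rewrite lerXn2r ?nnegrE ?expR_ge0 ?addr_ge0 ?mulr_ge0 ?exprn_ge0 ?expR_ge1Dx.
by rewrite -expRM_natl mulrCA.
Unshelve. all: by end_near. Qed.

Lemma riesz_mass_dyadic_cvg (tau : nat -> R) :
  (forall k j, (j < k)%N -> (2 * mu j <= mu k)%N) ->
  (fun n => riesz_mass (N n) mu (tau n) n) @ \oo --> (1 : R).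
Proof.
move=> gap; rewrite (_ : (fun n => _) = fun=> 1); first exact: cvg_cst.
by apply/funext => n; apply: riesz_mass_dyadic => //; exact: muN.
Qed.

End MassLimit.

(** * The limit, uniformly on bounded sets *)

Section ModGaussianLimit.
Context {R : realType}.

Lemma cexp_quartic_sub (z : R[i]) (Z s k : R) : cmod z <= Z ->
  Z ^+ 4 * `|s - k| <= 1 ->
  cmod (cexp (- (z ^+ 4 / 12 * s%:C)) - cexp (- (z ^+ 4 / 12 * k%:C))) <=
  expR (Z ^+ 4 * `|k|) * (expR 1 * (Z ^+ 4 * `|s - k|)).
Proof.
move=> zZ small.
have z4 r : cmod (z ^+ 4 / 12 * r%:C) <= Z ^+ 4 * `|r|.
  rewrite cmodM cmodR cmodM cmodV cmod_nat cmodX ler_wpM2r //.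
  rewrite ler_pdivrMr //; apply: (@le_trans _ _ (Z ^+ 4)).
    by rewrite lerXn2r ?nnegrE ?cmod_ge0 // (le_trans (cmod_ge0 z)).
  by rewrite ler_peMr ?exprn_even_ge0 // ler1n.
pose D := - (z ^+ 4 / 12 * (s - k)%:C).
have -> : - (z ^+ 4 / 12 * s%:C) = - (z ^+ 4 / 12 * k%:C) + D.
  by rewrite /D rmorphB /=; ring.
rewrite cexpD -[X in _ - X]mulr1 -mulrBr cmodM.
apply: ler_pM; rewrite ?cmod_ge0 //.
  by apply: le_trans (cmod_cexp_le _) _; rewrite ler_expR cmodN z4.
have D1 : cmod D <= Z ^+ 4 * `|s - k| by rewrite cmodN z4.
apply: le_trans (cexp_near1 (le_trans D1 small)) _.
by rewrite ler_wpM2l ?expR_ge0.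
Qed.

Variables (m : nat -> nat) (a : nat -> nat -> R) (N : nat -> nat) (kappa : R).
Notation d := (array_max a).
Notation mu := (fun k => m k.+1).
Hypothesis mN : forall n k, (k < n)%N -> (mu k <= N n)%N.
Hypothesis s4_cvg :
  (fun n => \sum_(1 <= k < n.+1) a k n ^+ 4) @ \oo --> kappa.
Hypothesis nd5_cvg : (fun n => n%:R * d n ^+ 5) @ \oo --> (0 : R).
Hypothesis mass_cvg : forall c : R, 0 <= c ->
  (fun n => riesz_mass (N n) mu (c * d n) n) @ \oo --> (1 : R).

Lemma walsh_sum_mod_gauss_bound (Z e : R) : 0 <= Z -> 0 < e ->
  \forall n \near \oo, forall z, cmod z <= Z ->
    cmod (cmgf (@unit_interval_prob R) (walsh_sum m a n) z *
          cexp (- ((array_norm a n ^+ 2)%:C * z ^+ 2 / 2)) -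
          cexp (- (z ^+ 4 / 12 * kappa%:C))) < e.
Proof.
move=> Z0 e0.
have [K K0 Kle] := @cmgf_gauss_le R.
have d_cvg := array_max_cvg0 nd5_cvg.
pose s4 n := \sum_(1 <= k < n.+1) a k n ^+ 4.
pose mass n := riesz_mass (N n) mu (2 * expR 1 * Z * d n) n.
pose B n := expR ((1 + K) * (Z ^+ 4 * s4 n)) *
    (mass n - 1 + K * Z ^+ 6 * (n%:R * d n ^+ 6)) +
  expR (Z ^+ 4 * `|kappa|) * (expR 1 * (Z ^+ 4 * `|s4 n - kappa|)).
have cst_cvg (c : R) : (fun=> c) @ \oo --> c by exact: cvg_cst.
have dist_cvg : (fun n => `|s4 n - kappa|) @ \oo --> (0 : R).
  rewrite -(normr0 R) -(subrr kappa); apply: cvg_norm.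
  by apply: cvgB => //; exact: s4_cvg.
have B_cvg : B @ \oo --> (0 : R).
  have -> : 0 = expR ((1 + K) * (Z ^+ 4 * kappa)) *
      (1 - 1 + K * Z ^+ 6 * 0) +
    expR (Z ^+ 4 * `|kappa|) * (expR 1 * (Z ^+ 4 * 0))
    by rewrite subrr !mulr0 !addr0 mulr0.
  apply: cvgD; last first.
    by apply: cvgM => //; apply: cvgM => //; apply: cvgM.
  apply: cvgM.
    apply: continuous_cvg; first exact: continuous_expR.
    by apply: cvgM => //; apply: cvgM => //; exact: s4_cvg.
  apply: cvgD.
    apply: cvgB => //; apply: mass_cvg.
    by rewrite !mulr_ge0 ?expR_ge0.
  by apply: cvgM => //; exact: array_max_cvgS nd5_cvg.
have below (u : nat -> R) c : u @ \oo --> (0 : R) -> 0 < c ->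
    \forall n \near \oo, u n < c.
  by move=> u0 c0; exact: cvgr_lt u0 _ c0.
have edZ_cvg : (fun n => expR 1 * (d n * Z)) @ \oo --> (0 : R).
  rewrite -[X in _ --> X](mulr0 (expR 1)) -(mul0r Z).
  by apply: cvgM => //; apply: cvgM.
have small_cvg : (fun n => Z ^+ 4 * `|s4 n - kappa|) @ \oo --> (0 : R).
  by rewrite -[X in _ --> X](mulr0 (Z ^+ 4)); exact: cvgM.
near=> n => z zZ.
have edZ : expR 1 * (d n * Z) <= 2^-1.
  by apply/ltW; near: n; apply: below edZ_cvg _; rewrite invr_gt0.
have small : Z ^+ 4 * `|s4 n - kappa| <= 1.
  by apply/ltW; near: n; apply: below small_cvg _.
have Be : B n < e by near: n; apply: below B_cvg _.
apply: le_lt_trans Be.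
rewrite (@walsh_sum_char _ _ (N n)); last by move=> k; exact: mN.
rewrite array_norm_sqr.
set F := _ * _; set S := cexp (- (z ^+ 4 / 12 * (s4 n)%:C)).
rewrite -(subrKA S); apply: le_trans (cmodD _ _) _; apply: lerD.
  have := Kle (N n) n mu (fun k => a k.+1 n) (d n) Z z (array_max_ge0 a n)
    (fun k => array_max_ge a k) zZ edZ.
  rewrite /S /s4 sum_array /mass.
  have -> : 2 * expR 1 * (d n * Z) = 2 * expR 1 * Z * d n by ring.
  suff -> : n%:R * (K * (d n * Z) ^+ 6) = K * Z ^+ 6 * (n%:R * d n ^+ 6) by [].
  by ring.
exact: cexp_quartic_sub.
Unshelve. all: by end_near. Qed.

End ModGaussianLimit.

(** * Mod-Gaussian convergence *)

(** Every point has a neighbourhood of bounded modulus, the unit ball. *)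
Lemma cvg_locally_uniformly_bounded (R : realType)
    (f : nat -> R[i]^o -> R[i]^o) (g : R[i]^o -> R[i]^o) (A : set R[i]^o) :
  (forall Z e : R, 0 <= Z -> 0 < e ->
    \forall n \near \oo, forall z, cmod z <= Z -> cmod (f n z - g z) < e) ->
  cvg_locally_uniformly A f g.
Proof.
move=> fg z _; exists (ball z 1); first exact: nbhsx_ballx.
move=> Q /uniform_nbhs[E [entE EQ]].
move: entE; rewrite -entourage_ballE => -[e e0 eE].
have e_real : e = (complex.Re e)%:C by rewrite RRe_real // gtr0_real.
have re0 : 0 < complex.Re e by rewrite -ltcR -e_real.
have Z0 : 0 <= cmod z + 1 by rewrite addr_ge0 ?cmod_ge0.
have := fg _ _ Z0 re0; apply: filterS => n fn.
apply: EQ => y [zy _]; apply: eE; rewrite /= /ball /= e_real distrC cmodE ltcR.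
apply: fn; have -> : y = z - (z - y) by rewrite opprB addrC subrK.
apply: le_trans (cmodBD _ _) _; rewrite lerD2l ltW // -ltcR.
by move: zy; rewrite /ball /= cmodE.
Qed.

Theorem theorem2p5 (R : realType) (q : R) (hq : 1 < q)
  (m : nat -> nat)
  (hm_pos : forall k, (1 <= k)%N -> (0 < m k)%N)
  (hm_incr : forall k, (1 <= k)%N -> (m k < m k.+1)%N)
  (hm_lac : forall k, (1 <= k)%N -> q <= (m k.+1)%:R / (m k)%:R)
  (a : nat -> nat -> R) (kappa4 : R)
  (hA : array_norm a @ \oo --> +oo)
  (hge2 : 2 <= q ->
    ((fun n : nat => \sum_(1 <= k < n.+1) a k n ^+ 4) @ \oo --> kappa4) /\
    ((fun n : nat => n%:R * array_max a n ^+ 5) @ \oo --> (0 : R)))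
  (hlt2 : q < 2 ->
    exists2 eps : R, 0 < eps &
      (fun n : nat => n%:R `^ (1 + eps) * array_max a n ^+ 3) @ \oo
        --> (0 : R)) :
  mod_gaussian_cvg
    (fun n => walsh_sum m a n : {RV (@unit_interval_prob R) >-> R})
    -oo%E +oo%E
    (fun n => array_norm a n ^+ 2)
    (fun z : R[i] =>
       if 2 <= q then cexp (- (z ^+ 4 / 12 * kappa4%:C)) else 1).
Proof.
pose mu k := m k.+1.
have mu_gt0 k : (0 < mu k)%N by exact: hm_pos.
have mu_ratio k : q <= (mu k.+1)%:R / (mu k)%:R by exact: hm_lac.
have mu_lt : forall i j, (i < j)%N -> (mu i < mu j)%N.
  exact: lacunary_gt hq mu_gt0 mu_ratio.
have muN n k : (k < n)%N -> (mu k <= mu n)%N by move=> /mu_lt/ltnW.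
pose kappa := if 2 <= q then kappa4 else 0.
have -> : (fun z : R[i] =>
    if 2 <= q then cexp (- (z ^+ 4 / 12 * kappa4%:C)) else 1) =
    fun z => cexp (- (z ^+ 4 / 12 * kappa%:C)).
  apply/funext => z; rewrite /kappa; case: ifP => // _.
  by rewrite mulr0 oppr0 cexp0.
(* The case distinction on [q] enters the limit only through these three facts;
   for [q < 2] they all follow from [n d_n^3 -> 0]. *)
have [s4_cvg nd5_cvg mass_cvg] : [/\
    (fun n => \sum_(1 <= k < n.+1) a k n ^+ 4) @ \oo --> kappa,
    (fun n => n%:R * array_max a n ^+ 5) @ \oo --> (0 : R) &
    forall c : R, 0 <= c ->
      (fun n => riesz_mass (mu n) mu (c * array_max a n) n) @ \oo --> (1 : R)].
  rewrite /kappa; have [q2|q2] := leP 2 q.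
    have [s4 nd5] := hge2 q2; split => // c c0.
    apply: riesz_mass_dyadic_cvg => // k j.
    exact: (lacunary_doubling hq mu_gt0 mu_ratio).
  have [eps eps0 /(power_rate_cvg eps0) nd3] := hlt2 q2.
  have nd4 := array_max_cvgS nd3.
  split; [exact: sum_quartic_cvg0 | exact: array_max_cvgS |] => c c0.
  have [M gap] := lacunary_gap hq mu_gt0 mu_ratio.
  apply: (riesz_mass_cvg1 mu_gt0 mu_lt muN gap).
  - by move=> n; rewrite mulr_ge0 ?array_max_ge0.
  - rewrite -[X in _ --> X](mulr0 c); apply: cvgM; first exact: cvg_cst.
    exact: array_max_cvg0 nd3.
  - rewrite (_ : (fun n => _) =
      fun n => c ^+ 3 * (n%:R * array_max a n ^+ 3)); last first.
      by apply/funext => n; rewrite exprMn mulrCA.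
    by rewrite -[X in _ --> X](mulr0 (c ^+ 3)); apply: cvgM => //; exact: cvg_cst.
split; first exact: ltNyr.
split; first exact: ltry.
split.
  move=> n z _.
  have := @cmgf_char_sum_exists R (mu n) n mu (fun k => a k.+1 n) z.
  by rewrite -(walsh_sum_char a (muN n)).
split.
  apply: (ger_cvgy _ hA); near=> n.
  have A1 : 1 <= array_norm a n by near: n; exact: (cvgryPge _).1 hA _.
  by rewrite expr2 ler_peMl // (le_trans ler01).
split; first by move=> z _; exact: derivable_cexp_quartic.
split; first by move=> x _; exact: cexp_neq0.
apply: cvg_locally_uniformly_bounded => Z e Z0 e0.
exact: (walsh_sum_mod_gauss_bound muN).
Unshelve. all: by end_near. Qed.
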